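(* Let $\hat u\in\mathcal U_{ad}$ be a weak minimum of the problem $\min\{F(u):u\in\mathcal U_{ad}\}$. Then $$\mathcal Q(z[v],v)\ge0\quad\text{for all }v\in C(\hat u).$$
   Context: $\mathcal H$ is a reflexive (real) Banach space, $\langle\cdot,\cdot\rangle$ the pairing between $\mathcal H^*$ and $\mathcal H$, $T>0$. The operator $\mathcal A$ (possibly unbounded) is the generator of a strongly continuous semigroup $e^{-t\mathcal A}$ on $\mathcal H$, with the sign convention $\mathcal Ay=-\lim_{t\downarrow0}(e^{-t\mathcal A}y-y)/t$. Data: $\Psi_0\in\mathcal H$, $f\in L^1(0,T;\mathcal H)$, $\mathcal B_1\in\mathcal H$, $\mathcal B_2\in\mathcal L(\mathcal H)$. A mild solution of $\dot y+\mathcal Ay=g$, $y(0)=y_0$ is $y(t)=e^{-t\mathcal A}y_0+\int_0^te^{-(t-s)\mathcal A}g(s)ds$ (where $g$ may depend on $y$). For $u\in L^1(0,T)$, the state $\Psi[u]\in C([0,T];\mathcal H)$ is the unique mild solution of $\dot\Psi+\mathcal A\Psi=f+u(\mathcal B_1+\mathcal B_2\Psi)$, $\Psi(0)=\Psi_0$. Cost: $Q,Q_T\in\mathcal L(\mathcal H,\mathcal H^* )$ are symmetric, $q(y)=\langle Qy,y\rangle$, $q_T(y)=\langle Q_Ty,y\rangle$, $\Psi_d\in L^\infty(0,T;\mathcal H)$, $\Psi_{dT}\in\mathcal H$, $\alpha\in\mathbb R$, and $F(u)=\alpha\int_0^Tu\,dt+\frac12\int_0^Tq(\Psi[u](t)-\Psi_d(t))\,dt+\frac12q_T(\Psi[u](T)-\Psi_{dT})$.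 Admissible controls: $\mathcal U_{ad}=\{u\in L^1(0,T):u_m\le u(t)\le u_M\text{ a.e.}\}$ with constants $u_m<u_M$. A control $\hat u\in\mathcal U_{ad}$ is a weak minimum if $F(\hat u)\le F(u)$ for all $u\in\mathcal U_{ad}$ sufficiently close to $\hat u$ in $L^\infty(0,T)$. Set $\hat\Psi=\Psi[\hat u]$, and let $\hat p\in C([0,T];\mathcal H^* )$ be the mild backward solution of $-\dot p+\mathcal A^*p=Q(\hat\Psi-\Psi_d)+\hat u\mathcal B_2^*p$, $p(T)=Q_T(\hat\Psi(T)-\Psi_{dT})$, i.e. $p(t)=e^{-(T-t)\mathcal A^*}p(T)+\int_t^Te^{-(s-t)\mathcal A^*}(Q(\hat\Psi-\Psi_d)+\hat u\mathcal B_2^*p)(s)ds$. Set $\Lambda(t)=\alpha+\langle\hat p(t),\mathcal B_1+\mathcal B_2\hat\Psi(t)\rangle$. For $v\in L^1(0,T)$, $z[v]$ is the mild solution of $\dot z+\mathcal Az=\hat u\mathcal B_2z+v(\mathcal B_1+\mathcal B_2\hat\Psi)$, $z(0)=0$. Further $$\mathcal Q(z,v)=\int_0^T\big(q(z(t))+2v(t)\langle\hat p(t),\mathcal B_2z(t)\rangle\big)dt+q_T(z(T)).$$ The critical cone is $C(\hat u)=\{v\in L^1(0,T):\Lambda(t)v(t)=0\text{ a.e. on }[0,T],\ v\ge0\text{ a.e. on }\{\hat u=u_m\},\ v\le0\text{ a.e. on }\{\hat u=u_M\}\}$. *)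

(* Defs.v *)
From HB Require Import structures.
From mathcomp Require Import all_boot all_order all_algebra.
From mathcomp Require Import all_classical all_reals all_analysis.

Set Implicit Arguments.
Unset Strict Implicit.
Unset Printing Implicit Defensive.
Import Order.TTheory GRing.Theory Num.Theory.
Import numFieldNormedType.Exports.
Local Open Scope classical_set_scope.
Local Open Scope ring_scope.

Section dual.
Context {R : realType} {V : normedModType R}.

Definition bounded_functional : {pred V -> R^o} :=
  mem [set f : V -> R^o | linear f /\ continuous f].

Record dual := Dual {
  dual_fun :> V -> R^o;
  dual_funP : dual_fun \in bounded_functional }.

HB.instance Definition _ := [isSub for dual_fun].
HB.instance Definition _ := [Choice of dual by <:].

Lemma bounded_functionalE (f : V -> R^o) :
  (f \in bounded_functional) = `[< linear f /\ continuous f >].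
Proof. by []. Qed.

Fact bounded_functional_submod_closed : submod_closed bounded_functional.
Proof.
split.
  by apply/asboolP; split=> [a x y|x]; [rewrite scaler0 addr0|exact: cvg_cst].
move=> a f g /asboolP[lf cf] /asboolP[lg cg]; apply/asboolP; split.
  move=> b x y; rewrite !fctE lf lg !scalerDr addrACA; congr (_ + _ + _).
  by rewrite !scalerA mulrC.
by move=> x; apply: cvgD; [apply: cvgZl_tmp; exact: cf|exact: cg].
Qed.

HB.instance Definition _ := GRing.isSubmodClosed.Build _ _ bounded_functional
  bounded_functional_submod_closed.
HB.instance Definition _ := [SubChoice_isSubLmodule of dual by <:].

Lemma dual_linear (p : dual) : linear p.
Proof. by have /asboolP[] := dual_funP p. Qed.

Lemma dual_continuous (p : dual) : continuous p.
Proof. by have /asboolP[] := dual_funP p. Qed.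

HB.instance Definition _ (p : dual) :=
  GRing.isLinear.Build R V R^o *:%R (dual_fun p) (dual_linear p).

Definition dual_norm (p : dual) : R :=
  sup [set `|p x| | x in [set x : V | `|x| <= 1]].

Lemma dual_bound (p : dual) : exists2 r, 0 < r & forall x, `|p x| <= r * `|x|.
Proof.
have /linear_bounded_continuous/linear_boundedP pb := @dual_continuous p.
by have [r r0 h] := pinfty_ex_gt0 pb; exists r.
Qed.

Lemma dual_has_sup (p : dual) :
  has_sup [set `|p x| | x in [set x : V | `|x| <= 1]].
Proof.
split; first by exists `|p 0|, 0 => //=; rewrite normr0.
have [r r0 h] := dual_bound p; exists r => _ [x /= x1 <-].
by rewrite (le_trans (h x))// ler_piMr// ltW.
Qed.

Lemma dual_norm_ge (p : dual) (x : V) : `|x| <= 1 -> `|p x| <= dual_norm p.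
Proof. by move=> x1; apply: sup_upper_bound; [exact: dual_has_sup|exists x]. Qed.

Lemma dual_norm_le (p : dual) (r : R) :
  (forall x, `|x| <= 1 -> `|p x| <= r) -> dual_norm p <= r.
Proof.
move=> h; apply: ge_sup; first by have [] := dual_has_sup p.
by move=> _ [x /= x1 <-]; exact: h.
Qed.

Lemma dual_normD (p q : dual) : dual_norm (p + q) <= dual_norm p + dual_norm q.
Proof.
apply: dual_norm_le => x x1.
by rewrite (le_trans (ler_normD _ _))// lerD// dual_norm_ge.
Qed.

Lemma dual_normZ_le (a : R) (p : dual) :
  dual_norm (a *: p) <= `|a| * dual_norm p.
Proof.
by apply: dual_norm_le => x x1; rewrite normrM ler_wpM2l// dual_norm_ge.
Qed.

Lemma dual_normZ (a : R) (p : dual) : dual_norm (a *: p) = `|a| * dual_norm p.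
Proof.
apply/eqP; rewrite eq_le dual_normZ_le/=.
have [->|a0] := eqVneq a 0.
  rewrite normr0 mul0r (le_trans _ (@dual_norm_ge _ 0 _))//.
  by rewrite normr0.
rewrite -ler_pdivlMl ?normr_gt0// -normfV.
by rewrite -[leLHS](congr1 dual_norm (scalerK a0 p)) dual_normZ_le.
Qed.

Lemma dual_norm0_eq0 (p : dual) : dual_norm p = 0 -> p = 0.
Proof.
move=> p0; apply/val_inj/funext => x /=.
have [->|x0] := eqVneq x 0; first exact: (linear0 p).
have := @dual_norm_ge p (`|x|^-1 *: x).
rewrite normfZV// lexx p0 => /(_ isT); rewrite linearZ normr_le0.
by rewrite scaler_eq0 invr_eq0 normr_eq0 (negbTE x0) => /eqP.
Qed.

HB.instance Definition _ := Lmodule_isNormed.Build R dual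
  dual_normD dual_normZ dual_norm0_eq0.

End dual.
Arguments dual {R} V.

Section operators.
Context {R : realType} {V : normedModType R}.

Definition reflexive_space : Prop :=
  forall phi : dual (dual V), exists y : V, forall p : dual V, phi p = p y.

Fact adjoint_subproof (B : {linear V -> V}) (cB : continuous B) (p : dual V) :
  (p \o B : V -> R^o) \in @bounded_functional R V.
Proof.
apply/asboolP; split=> [a x y|x]; first by rewrite /= !linearP.
by apply: continuous_comp; [exact: cB|exact: dual_continuous].
Qed.

Definition adjoint (B : {linear V -> V}) (cB : continuous B) (p : dual V) :
  dual V := Dual (adjoint_subproof cB p).

Definition c0_semigroup (S : R -> {linear V -> V}) : Prop :=
  [/\ forall t, 0 <= t -> continuous (S t),
      forall y, S 0 y = y,
      forall s t y, 0 <= s -> 0 <= t -> S (s + t) y = S s (S t y) &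
      forall y, S t y @[t --> 0^'+] --> y].

(** Unbounded operators are given by their graphs.  Sign convention: [A]
   generates the semigroup written exp(-tA). *)
Definition generates (A : set (V * V)) (S : R -> {linear V -> V}) : Prop :=
  c0_semigroup S /\
  forall y w, A (y, w) <-> - (h^-1 *: (S h y - y)) @[h --> 0^'+] --> w.

Definition adjoint_graph (A : set (V * V)) : set (dual V * dual V) :=
  [set pr : dual V * dual V | forall y w, A (y, w) -> pr.1 w = pr.2 y].

End operators.
Arguments reflexive_space {R} V.

(** As for the library's scalar [integrable], elements of L^p spaces are
   represented by functions that are Borel measurable, not merely equal almost
   everywhere to a Borel measurable function; strong measurability is thus
   an everywhere condition. *)

Section bochner.
Context {R : realType} {V : normedModType R}.
Notation mu := (@lebesgue_measure R).

Definition measurable_simple (s : {fimfun R >-> V}) : Prop :=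
  forall x, measurable (s @^-1` [set x]).

Definition simple_integral (a b : R) (s : {fimfun R >-> V}) : V :=
  \sum_(x \in [set: V]) fine (mu (`[a, b] `&` s @^-1` [set x])) *: x.

Definition strongly_measurable (a b : R) (g : R -> V) : Prop :=
  exists2 s : nat -> {fimfun R >-> V}, (forall n, measurable_simple (s n)) &
    forall t, a <= t <= b -> s n t @[n --> \oo] --> g t.

Definition has_bochner_integral (a b : R) (g : R -> V) (I : V) : Prop :=
  strongly_measurable a b g /\
  exists s : nat -> {fimfun R >-> V},
    [/\ forall n, measurable_simple (s n),
        (\int[mu]_(t in `[a, b]) (`|g t - s n t|)%:E)%E @[n --> \oo] --> 0%E &
        simple_integral a b (s n) @[n --> \oo] --> I].

Definition bochner_L1 (a b : R) (g : R -> V) : Prop :=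
  strongly_measurable a b g /\
  (\int[mu]_(t in `[a, b]) (`|g t|)%:E < +oo)%E.

Definition bochner_Linfty (a b : R) (g : R -> V) : Prop :=
  strongly_measurable a b g /\
  exists M : R, {ae mu, forall t, a <= t <= b -> `|g t| <= M}.

(** Mild solution on [0, T] of y' + A y = g, y(0) = y0, where [S t] is
   exp(-tA). *)
Definition mild_solution (S : R -> {linear V -> V}) (T : R) (y0 : V)
    (g y : R -> V) : Prop :=
  {within `[0, T], continuous y} /\
  forall t, 0 <= t <= T ->
    has_bochner_integral 0 t (fun s => S (t - s) (g s)) (y t - S t y0).

(** Mild solution on [0, T] of - p' + A p = g, p(T) = pT. *)
Definition backward_mild_solution (S : R -> {linear V -> V}) (T : R) (pT : V)
    (g p : R -> V) : Prop :=
  {within `[0, T], continuous p} /\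
  forall t, 0 <= t <= T ->
    has_bochner_integral t T (fun s => S (s - t) (g s)) (p t - S (T - t) pT).

End bochner.

Section scalar_controls.
Context {R : realType}.
Notation mu := (@lebesgue_measure R).

Definition L1 (T : R) : set (R -> R) :=
  [set u | mu.-integrable `[0, T] (EFin \o u)].

Definition Linfty_norm (T : R) (u : R -> R) : \bar R :=
  Lnorm mu +oo%E (EFin \o (u \_ `[0, T])).

Definition admissible (T um uM : R) : set (R -> R) :=
  [set u | L1 T u /\ {ae mu, forall t, 0 <= t <= T -> um <= u t <= uM}].

Definition weak_minimum (T : R) (Uad : set (R -> R)) (F : (R -> R) -> R)
    (uh : R -> R) : Prop :=
  Uad uh /\
  exists2 eps : R, 0 < eps &
    forall u, Uad u -> (Linfty_norm T (u \- uh)%R < eps%:E)%E -> F uh <= F u.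

Definition critical_cone (T um uM : R) (Lam uh : R -> R) : set (R -> R) :=
  [set v | [/\ L1 T v,
    {ae mu, forall t, 0 <= t <= T -> Lam t * v t = 0},
    {ae mu, forall t, 0 <= t <= T -> uh t = um -> 0 <= v t} &
    {ae mu, forall t, 0 <= t <= T -> uh t = uM -> v t <= 0}]].

End scalar_controls.

Section problem.
Context {R : realType} {H : normedModType R}.
Notation mu := (@lebesgue_measure R).

Definition quad (Q : H -> dual H) (y : H) : R := Q y y.

(** [psi] stands for the state associated with [u]. *)
Definition cost (T alpha : R) (Q QT : H -> dual H) (Psid : R -> H) (PsidT : H)
    (u : R -> R) (psi : R -> H) : R :=
  alpha * (\int[mu]_(t in `[0, T]) u t)
  + 2^-1 * (\int[mu]_(t in `[0, T]) quad Q (psi t - Psid t))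
  + 2^-1 * quad QT (psi T - PsidT).

Definition switching (alpha : R) (B1 : H) (B2 : H -> H) (p : R -> dual H)
    (psi : R -> H) (t : R) : R :=
  alpha + p t (B1 + B2 (psi t)).

Definition second_variation (T : R) (Q QT : H -> dual H) (B2 : H -> H)
    (p : R -> dual H) (z : R -> H) (v : R -> R) : R :=
  \int[mu]_(t in `[0, T]) (quad Q (z t) + 2 * v t * p t (B2 (z t)))
  + quad QT (z T).

End problem.

(* Main.v *)
Require Import Defs.
From HB Require Import structures.
From mathcomp Require Import all_boot all_order all_algebra.
From mathcomp Require Import all_classical all_reals all_analysis.
From mathcomp Require Import measurable_realfun ess_sup_inf.
From mathcomp Require Import lra.
Set Implicit Arguments.
Unset Strict Implicit.
Unset Printing Implicit Defensive.
Import Order.TTheory GRing.Theory Num.Theory.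
Import numFieldNormedType.Exports.
Local Open Scope classical_set_scope.
Local Open Scope ring_scope.

(** Why the theorem holds.  Fix [v] in the critical cone and let [psi] be the
   state of [uh].  With the step s_n = (n+1)^-2, let v_n be [v] cut off to zero
   where |v| > n+1 or where uh + s_n v leaves [um, uM].  The sign conditions of
   the cone make v_n(t) = v(t) for large n, at almost every t, so v_n tends to
   [v] in L^1.  The control u_n = uh + s_n v_n is admissible and tends to [uh]
   in L^oo; hence F(uh) <= F(u_n) for large n.

   Let w_n = (Psi[u_n] - psi) / s_n.  This difference quotient is itself a mild
   solution of
     w' + A w = uh B2 w + v_n (B1 + B2 Psi[u_n]),   w(0) = 0,
   and because the cost is quadratic in the state, testing the equation of w_n
   against the costate gives an identity without remainder
   ([cost_expansion]), in which Q(., .) stands for [second_variation]: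
     F(u_n) = F(uh) + s_n int Lambda v_n + s_n^2 / 2 * Q(w_n, v_n).
   The middle term is zero, since Lambda v = 0 almost everywhere and v_n is
   [v] or 0 at each time.  Hence Q(w_n, v_n) >= 0 for large n.  Gronwall's
   inequality for mild solutions ([mild_gronwall]) bounds w_n and makes it
   converge uniformly to z[v]; [second_variation_close] then passes to the limit
   and gives Q(z[v], v) >= 0.  One sequence serves both for removing the
   truncation and for letting the step tend to zero.

   The identity rests on the duality
     <p(T), w(T)> + int <g, w> = int <p, k>
   between a forward mild solution w with source k and a backward one p with
   source g ([duality_formula]), which is Fubini's theorem on the triangle
   0 <= s <= t <= T.  It needs the backward semigroup [Sd] to be the adjoint
   of [S] ([adjoint_semigroupE]).  As [Sd] is only given by its generator, this
   has to be proved: for p and y in the two domains, the pairing of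
   Sd(t - s) p with S(s) y has increments of order o(h) in s, hence is
   constant; and both domains are dense, because they contain the means of
   orbits, which exist by reflexivity.

   Vector-valued integrals are used only through continuous functionals.  A
   Bochner integral commutes with them ([bochner_weak]), and the Hahn-Banach
   theorem ([norming_functional]) turns scalar estimates back into norm
   estimates. *)

(** * Bounded linear maps and norming functionals *)
Section bounded_linear.
Context {R : realType}.

Lemma linear_bound_continuous {V W : normedModType R} (f : V -> W) (C : R) :
  linear f -> (forall x, `|f x| <= C * `|x|) -> continuous f.
Proof.
move=> lf fC.
pose L : {linear V -> W} := HB.pack f (GRing.isLinear.Build _ _ _ _ _ lf).
apply: (@bounded_linear_continuous _ _ _ L); apply/linear_boundedP.
near=> r => x /=; apply: (le_trans (fC x)); apply: ler_wpM2r => [//|].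
by near: r; apply: nbhs_pinfty_ge; rewrite num_real.
Unshelve. all: by end_near. Qed.

Lemma continuous_linear_bound {V W : normedModType R} (f : {linear V -> W}) :
  continuous f -> exists2 C, 0 < C & forall x, `|f x| <= C * `|x|.
Proof.
move=> /linear_bounded_continuous/linear_boundedP fb.
by have [r r0 h] := pinfty_ex_gt0 fb; exists r.
Qed.

Lemma dual_of_bounded {V : normedModType R} (f : V -> R) (C : R) :
  (forall a x y, f (a *: x + y) = a * f x + f y) ->
  (forall x, `|f x| <= C * `|x|) -> exists p : dual V, p =1 f.
Proof.
move=> lf fC.
have bm : (f : V -> R^o) \in @bounded_functional R V.
  by apply/asboolP; split => //; exact: (@linear_bound_continuous _ R^o _ C).
by exists (Dual bm).
Qed.

End bounded_linear.

Section norming_functional.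
Context {R : realType} {V : normedModType R}.

Definition sublinear (m : V -> R) : Prop :=
  (forall x y, m (x + y) <= m x + m y) /\
  (forall a x, 0 <= a -> m (a *: x) = a * m x).

Lemma sublinear0 m : sublinear m -> m 0 = 0.
Proof. by case=> _ /(_ 0 0 (lexx _)); rewrite scale0r mul0r. Qed.

Lemma sublinear_geN m x : sublinear m -> - m (- x) <= m x.
Proof.
move=> sm; have := sm.1 x (- x); rewrite subrr sublinear0// => h.
by rewrite lerNl -subr_ge0 opprK addrC.
Qed.

(** The largest sublinear functional below [m] that is at most [- m z] at [- z];
   it is linear on the line of [z]. *)
Definition tilt (m : V -> R) (z x : V) : R :=
  inf [set m (x + t *: z) - t * m z | t in [set t : R | 0 <= t]].

Section tilt_lemmas.
Variables (m : V -> R) (z : V).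
Hypothesis sm : sublinear m.

Lemma tilt_lbound x :
  lbound [set m (x + t *: z) - t * m z | t in [set t : R | 0 <= t]] (- m (- x)).
Proof.
move=> _ [t /= t0 <-]; rewrite lerBrDr -sm.2//.
have := sm.1 (x + t *: z) (- x); rewrite addrAC subrr add0r => h.
by rewrite addrC lerBlDr.
Qed.

Lemma tilt_has_inf x :
  has_inf [set m (x + t *: z) - t * m z | t in [set t : R | 0 <= t]].
Proof.
split; first by exists (m (x + 0 *: z) - 0 * m z); exists 0 => //=.
by exists (- m (- x)); exact: tilt_lbound.
Qed.

Lemma tilt_le x t : 0 <= t -> tilt m z x <= m (x + t *: z) - t * m z.
Proof. by move=> t0; apply: ge_inf; [exact: (tilt_has_inf x).2|exists t]. Qed.

Lemma tilt_le_self x : tilt m z x <= m x.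
Proof. by have := tilt_le x (lexx 0); rewrite scale0r mul0r addr0 subr0. Qed.

Lemma tilt_ge x r :
  (forall t, 0 <= t -> r <= m (x + t *: z) - t * m z) -> r <= tilt m z x.
Proof.
move=> h; apply: lb_le_inf; first exact: (tilt_has_inf x).1.
by move=> _ [t /= t0 <-]; exact: h.
Qed.

Lemma tilt_sublinear : sublinear (tilt m z).
Proof.
split=> [x y|a x a0].
  rewrite -lerBlDr; apply: tilt_ge => t t0.
  rewrite lerBlDr [leRHS]addrC -lerBlDr; apply: tilt_ge => s s0; rewrite lerBlDr.
  apply: (le_trans (tilt_le _ (addr_ge0 t0 s0))).
  have -> : x + y + (t + s) *: z = (x + t *: z) + (y + s *: z).
    by rewrite scalerDl addrACA.
  by rewrite (le_trans (lerB (sm.1 _ _) (lexx _)))//; lra.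
have [->|an0] := eqVneq a 0.
  rewrite scale0r mul0r; apply/eqP; rewrite eq_le; apply/andP; split.
    by rewrite -[leRHS](sublinear0 sm) tilt_le_self.
  by apply: tilt_ge => t t0; rewrite add0r sm.2// subrr.
have ap : 0 < a by rewrite lt0r an0.
apply/eqP; rewrite eq_le; apply/andP; split.
  rewrite mulrC -ler_pdivrMr//; apply: tilt_ge => t t0; rewrite ler_pdivrMr//.
  apply: (le_trans (tilt_le _ (mulr_ge0 a0 t0))).
  by rewrite -scalerA -scalerDr sm.2// -mulrA mulrBl mulrC [t * _ * a]mulrC.
apply: tilt_ge => t t0.
have := tilt_le x (divr_ge0 t0 a0); rewrite -(ler_pM2l ap) => /le_trans; apply.
have e : a * (t / a) = t by rewrite mulrC divfK.
by rewrite mulrBr -(sm.2 a)// scalerDr scalerA e mulrA e.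
Qed.

End tilt_lemmas.

(** A minimal [m] coincides with each of its tilts, so the term t = 1 of the
   infimum gives [m x <= m (x + z) - m z], which is superadditivity. *)
Lemma minimal_sublinear_linear (m : V -> R) : sublinear m ->
  (forall m', sublinear m' -> (forall x, m' x <= m x) -> m' = m) ->
  forall a x y, m (a *: x + y) = a * m x + m y.
Proof.
move=> sm minm.
have mt z : tilt m z = m.
  by apply: minm; [exact: tilt_sublinear|exact: tilt_le_self].
have mD x y : m (x + y) = m x + m y.
  apply/eqP; rewrite eq_le sm.1/=.
  have := tilt_le y sm x (ler01); rewrite mt scale1r mul1r; lra.
have mN x : m (- x) = - m x.
  by apply/eqP; rewrite -subr_eq0 opprK -mD addNr sublinear0.
move=> a x y; rewrite mD; congr (_ + _).
have [a0|a0] := leP 0 a; first exact: sm.2.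
by have := mN (- a *: x); rewrite sm.2 ?oppr_ge0 ?(ltW a0)// scaleNr opprK mulNr opprK.
Qed.

(** Zorn's lemma for the reversed pointwise order.  The pointwise infimum of a
   chain is finite because each member is at least [- N (- x)], and subadditive
   because one of any two members lies below the other. *)
Lemma minimal_sublinear_exists (N : V -> R) : sublinear N ->
  exists m, [/\ sublinear m, forall x, m x <= N x &
    forall m', sublinear m' -> (forall x, m' x <= m x) -> m' = m].
Proof.
move=> sN.
pose X := {m : V -> R | sublinear m /\ forall x, m x <= N x}.
pose Rel (a b : X) := `[< forall x, sval b x <= sval a x >].
have [|||A tA|t tmin] := @Zorn X Rel.
- by move=> t; apply/asboolP.
- by move=> r s t /asboolP rs /asboolP st; apply/asboolP => x; exact: le_trans (rs x).
- move=> [s ps] [t pt] /asboolP /= st /asboolP /= ts; apply: eq_exist.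
  by apply/funext => x; apply/eqP; rewrite eq_le st ts.
- have [A0|/set0P[m0 Am0]] := eqVneq A set0.
    by exists (exist _ N (conj sN (fun x => lexx _))) => s; rewrite A0.
  pose E x := [set sval m x | m in A].
  have lbE x : lbound (E x) (- N (- x)).
    move=> _ [[m [sm mN]] _ <-] /=; apply: le_trans (sublinear_geN _ sm).
    by rewrite lerN2.
  have iE x : has_inf (E x).
    by split; [exists (sval m0 x), m0|exists (- N (- x)); exact: lbE].
  pose m x := inf (E x).
  have mle x a : A a -> m x <= sval a x.
    by move=> Aa; apply: ge_inf; [exact: (iE x).2|exists a].
  have mge x r : (forall a, A a -> r <= sval a x) -> r <= m x.
    move=> h; apply: lb_le_inf; first exact: (iE x).1.
    by move=> _ [a Aa <-]; exact: h.
  have sm : sublinear m.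
    split=> [x y|a x a0].
      rewrite -lerBlDr; apply: (mge) => b Ab; rewrite lerBlDr [leRHS]addrC -lerBlDr.
      apply: (mge) => c Ac; rewrite lerBlDr.
      have [/asboolP bc|/asboolP cb] := tA _ _ Ab Ac.
        apply: (le_trans (mle _ _ Ac)); apply: (le_trans ((svalP c).1.1 _ _)).
        by rewrite addrC lerD.
      apply: (le_trans (mle _ _ Ab)); apply: (le_trans ((svalP b).1.1 _ _)).
      by rewrite addrC lerD.
    have [->|an0] := eqVneq a 0.
      rewrite scale0r mul0r; apply/eqP; rewrite eq_le; apply/andP; split.
        by rewrite (le_trans (mle _ _ Am0))// (sublinear0 (svalP m0).1).
      by apply: (mge) => b _; rewrite (sublinear0 (svalP b).1).
    have ap : 0 < a by rewrite lt0r an0.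
    apply/eqP; rewrite eq_le; apply/andP; split.
      rewrite mulrC -ler_pdivrMr//; apply: (mge) => b Ab; rewrite ler_pdivrMr//.
      by rewrite (le_trans (mle _ _ Ab))// (svalP b).1.2// mulrC.
    by apply: (mge) => b Ab; rewrite (svalP b).1.2// ler_pM2l// mle.
  have mN x : m x <= N x by exact: le_trans (mle x _ Am0) ((svalP m0).2 x).
  by exists (exist _ m (conj sm mN)) => s As; apply/asboolP => x /=; exact: mle.
exists (sval t); split; [exact: (svalP t).1|exact: (svalP t).2|].
move=> m' sm' m't.
have m'N x : m' x <= N x by exact: le_trans (m't x) ((svalP t).2 x).
have /tmin <- // : Rel t (exist _ m' (conj sm' m'N)) by apply/asboolP.
Qed.

Lemma norm_sublinear : sublinear (fun x : V => `|x|).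
Proof.
split=> [x y|a x a0]; first exact: ler_normD.
by rewrite normrZ ger0_norm.
Qed.

(** The tilt of the norm along [x] takes a value at most [- `|x|] at [- x], and
   so does any linear functional below it, whose value at [x] is then at least
   [`|x|].  No extension from a subspace is involved. *)
Lemma norming_functional (x : V) :
  exists2 p : dual V, (forall y, `|p y| <= `|y|) & p x = `|x|.
Proof.
have [m [sm mle mmin]] :=
  minimal_sublinear_exists (tilt_sublinear x norm_sublinear).
have mlin := minimal_sublinear_linear sm mmin.
have mN y : m y <= `|y|.
  by rewrite (le_trans (mle y))// (tilt_le_self _ norm_sublinear).
have mNy y : m (- y) = - m y.
  by have := mlin (-1) y 0; rewrite scaleN1r !addr0 (sublinear0 sm) addr0 mulN1r.
have mabs y : `|m y| <= `|y|.
  by rewrite ler_norml mN andbT lerNl -mNy (le_trans (mN _))// normrN.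
have [|p pm] := @dual_of_bounded _ _ m 1 mlin; first by move=> y; rewrite mul1r.
exists p => [y|]; rewrite pm//.
apply/eqP; rewrite eq_le mN/=.
have := mle (- x); rewrite mNy => h.
have := tilt_le x norm_sublinear (- x) ler01.
by rewrite scale1r mul1r addNr normr0 sub0r; lra.
Qed.

End norming_functional.

(** * The dual space is complete *)
Section dual_complete.
Context {R : realType} {V : normedModType R}.

Lemma dual_le (p : dual V) (x : V) : `|p x| <= `|p| * `|x|.
Proof.
have [->|x0] := eqVneq x 0; first by rewrite linear0 !normr0 mulr0.
have := @dual_norm_ge _ _ p (`|x|^-1 *: x).
rewrite normfZV// lexx => /(_ isT); rewrite linearZ/= normrM normfV normr_id.
by rewrite mulrC ler_pdivrMr ?normr_gt0.
Qed.

Lemma dual_norm_le_bound (p : dual V) (C : R) : 0 <= C ->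
  (forall x, `|p x| <= C * `|x|) -> `|p| <= C.
Proof.
move=> C0 pC; apply: dual_norm_le => x x1; rewrite (le_trans (pC x))//.
by rewrite ler_piMr.
Qed.

Lemma dualDE (p q : dual V) x : (p + q) x = p x + q x.
Proof. by []. Qed.

Lemma dualBE (p q : dual V) x : (p - q) x = p x - q x.
Proof. by []. Qed.

Lemma dualZE (a : R) (p : dual V) x : (a *: p) x = a * p x.
Proof. by []. Qed.

Lemma dual_evalB (p : dual V) x y : p (x - y) = (p x - p y : R).
Proof. exact: linearB. Qed.

Lemma dual_evalD (p : dual V) x y : p (x + y) = (p x + p y : R).
Proof. exact: linearD. Qed.

Lemma dual_evalZ (p : dual V) a x : p (a *: x) = (a * p x : R).
Proof. exact: linearZ. Qed.

Lemma dual_comp_continuous {T : topologicalType} (p : dual V) (c : T -> V) :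
  continuous c -> continuous (fun s => p (c s) : R).
Proof.
move=> cc s; apply: (@continuous_comp _ _ R^o c p); first exact: cc.
exact: dual_continuous.
Qed.

(** A Cauchy filter of functionals converges pointwise; the uniform estimate
   survives in the pointwise limit, which is therefore bounded and the limit in
   norm.  Completeness makes the uniform boundedness principle available for
   the semigroup on the dual. *)
Lemma dual_complete (F : set_system (dual V)) :
  ProperFilter F -> cauchy F -> cvg F.
Proof.
move=> FF /cauchyP Fc.
have Fx x : cvg ((fun p : dual V => p x : R) @ F).
  apply: cauchy_cvg; apply: cauchy_exP => e e0.
  have x0 : 0 < `|x| + 1 by rewrite ltr_wpDl.
  have [p0 Fp0] := Fc _ (divr_gt0 e0 x0); exists (p0 x).
  apply: (@filterS _ F _ (ball p0 (e / (`|x| + 1)))) => // p.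
  rewrite /= -!ball_normE /= -dualBE => h; rewrite (le_lt_trans (dual_le _ _))//.
  move: h; rewrite ltr_pdivlMr// => h; rewrite (le_lt_trans _ h)//.
  by rewrite ler_wpM2l// lerDl.
pose l x := lim ((fun p : dual V => p x : R) @ F).
have lcvg x : (fun p : dual V => p x : R) @ F --> l x by exact: Fx.
have lfar e p0 : F (ball p0 e) -> forall x, `|p0 x - l x| <= e * `|x|.
  move=> Fe x.
  apply: (@closed_cvg _ _ F _ (fun p : dual V => p x : R)
    [set r | `|p0 x - r| <= e * `|x|]) => //.
  - rewrite (_ : [set r | _] = closed_ball_ Num.norm (p0 x) (e * `|x|))//.
    exact: closed_closed_ball_.
  - near=> p; have : ball p0 e p by near: p; exact: Fe.
    rewrite -!ball_normE /= -dualBE => /ltW h.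
    by rewrite (le_trans (dual_le _ _))// ler_wpM2r.
have llin a x y : l (a *: x + y) = a * l x + l y.
  apply: cvg_lim => //.
  have -> : (fun p : dual V => p (a *: x + y) : R) =
            (fun p : dual V => a * p x + p y).
    by apply/funext => p; rewrite linearP.
  by apply: cvgD => //; apply: cvgMr.
have [p1 Fp1] := Fc 1 ltr01.
have lb x : `|l x| <= (`|p1| + 1) * `|x|.
  rewrite mulrDl -[l x](subrK (p1 x)) addrC (le_trans (ler_normD _ _))// lerD//.
    exact: dual_le.
  by rewrite distrC (lfar _ _ Fp1).
have [p pl] := dual_of_bounded llin lb.
apply/cvg_ex; exists p; apply/cvgrPdist_le => e e0.
have [p0 Fp0] := Fc _ (divr_gt0 e0 (ltr0Sn R 1)).
near=> q.
have h : ball p0 (e / 2) q by near: q; exact: Fp0.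
apply: dual_norm_le_bound; first exact: ltW.
move=> x; rewrite dualBE pl -[_ - _](subrKA (p0 x)).
rewrite (le_trans (ler_normD _ _))// [e]splitr mulrDl lerD//.
  by rewrite distrC (lfar _ _ Fp0).
move: h; rewrite -ball_normE/= -dualBE => /ltW h.
by rewrite (le_trans (dual_le _ _))// ler_wpM2r.
Unshelve. all: by end_near. Qed.

HB.instance Definition _ := Uniform_isComplete.Build (dual V) dual_complete.

End dual_complete.

(** * Strongly continuous semigroups *)
Section clamp.
Context {R : realType}.

(** Composition with [clamp a b] extends a function given on [a, b] by
   constants, so that continuity within the interval becomes continuity on the
   line. *)
Definition clamp (a b s : R) : R := Num.max a (Num.min s b).
Arguments clamp : simpl never.

Lemma clamp_id a b s : a <= s <= b -> clamp a b s = s.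
Proof. by case/andP=> as_ sb; rewrite /clamp (min_idPl sb) (max_idPr as_). Qed.

Lemma clamp_itv a b s : a <= b -> a <= clamp a b s <= b.
Proof. by move=> ab; rewrite /clamp le_max lexx/= ge_max ab/= ge_min lexx orbT. Qed.

Lemma clamp_continuous a b : continuous (clamp a b).
Proof.
move=> s; apply: (@continuous_max R R (cst a) (fun s => Num.min s b)).
  exact: cst_continuous.
apply: (@continuous_min R R id (cst b)); first exact: cvg_id.
exact: cst_continuous.
Qed.

Lemma within_continuous_clamp {V : topologicalType} a b (f : R -> V) : a <= b ->
  {within `[a, b], continuous f} -> continuous (f \o clamp a b).
Proof.
move=> ab /subspace_continuousP cf s.
have cs : clamp a b s \in `[a, b] by rewrite in_itv/= clamp_itv.
apply: (cvg_comp _ _ _ (cf _ cs)) => A; rewrite /= /within /= => wA.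
apply: (@filterS _ (nbhs s) _ _ _ _ (clamp_continuous wA)) => x /=; apply.
by have := clamp_itv x ab; rewrite in_itv.
Qed.

Lemma clamp_within_continuous {V : topologicalType} a b (f : R -> V) :
  continuous (f \o clamp a b) -> {within `[a, b], continuous f}.
Proof.
move=> cf.
suff: {within `[a, b], continuous (f \o clamp a b)}.
  apply: subspace_eq_continuous => s; rewrite inE/= in_itv/= => sab.
  by rewrite /from_subspace /= clamp_id.
exact: continuous_subspaceT.
Qed.

End clamp.

Section semigroup.
Context {R : realType} {V : completeNormedModType R}.
Variable (S : R -> {linear V -> V}).
Hypothesis S0 : c0_semigroup S.

Lemma c0_small y e : 0 < e -> exists2 d, 0 < d &
  forall h, 0 <= h <= d -> `|S h y - y| <= e.
Proof.
case: S0 => _ S_0 _ Sr e0.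
have := Sr y => /cvgrPdist_le/(_ _ e0) [d /= d0 hd].
exists (d / 2); first exact: divr_gt0.
move=> h /andP[]; rewrite le_eqVlt => /orP[/eqP <- _|h0 hd2].
  by rewrite S_0 subrr normr0 ltW.
rewrite distrC; apply: hd => //=.
by rewrite sub0r normrN gtr0_norm// (le_lt_trans hd2)// ltr_pdivrMr// ltr_pMr// ltr1n.
Qed.

(** If no bound held near 0, there would be times t_n <= 1/(n+1) at which the
   norm of [S] exceeds n+1, while S(t_n) x converges to x for every x: this
   contradicts the uniform boundedness principle. *)
Lemma c0_bound_near0 : exists2 d, 0 < d & exists2 M, 1 <= M &
  forall h x, 0 <= h <= d -> `|S h x| <= M * `|x|.
Proof.
case: (S0) => cS S_0 _ _; apply: contrapT => nb.
have seq n : exists t, 0 <= t <= n.+1%:R^-1 /\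
    exists x, n.+1%:R * `|x| < `|S t x|.
  apply: contrapT => h; apply: nb; exists n.+1%:R^-1; first by rewrite invr_gt0.
  exists n.+1%:R; first by rewrite ler1n.
  move=> t x tn; rewrite leNgt; apply/negP => tx; apply: h.
  by exists t; split => //; exists x.
pose t n := sval (cid (seq n)).
have tP n : 0 <= t n <= n.+1%:R^-1 by rewrite /t; case: cid => ? [].
have tx n : exists x, n.+1%:R * `|x| < `|S (t n) x|.
  by rewrite /t; case: cid => ? [].
pose F := [set f : V -> V | exists n, f = S (t n)].
have [|x|M FM] := @Banach_Steinhauss R V V F _ _ 1.
- move=> f [n ->]; split; last by move=> a u v; rewrite linearP.
  have [C C0 SC] := continuous_linear_bound (cS _ (andP (tP n)).1).
  by move=> r; exists (C * r) => x xr; rewrite (le_trans (SC x))// ler_pM2l.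
- have [d d0 hd] := c0_small x ltr01.
  have [N dN] : exists N : nat, d^-1 <= N.+1%:R.
    by exists (Num.truncn d^-1); rewrite ltW// truncnS_gt.
  have dn n : (N <= n)%N -> `|S (t n) x| <= 1 + `|x|.
    move=> Nn; rewrite -[S _ x](subrK x) (le_trans (ler_normD _ _))// lerD2r.
    apply: hd; have /andP[-> tn] /= := tP n; rewrite (le_trans tn)//.
    rewrite invf_ple ?posrE// (le_trans dN)// ler_nat ltnS//.
  exists (1 + `|x| + \sum_(i < N) `|S (t i) x|) => f [n ->].
  have [Nn|nN] := leqP N n.
    by rewrite (le_trans (dn _ Nn))// lerDl sumr_ge0.
  rewrite (bigD1 (Ordinal nN))//= addrCA lerDl addr_ge0 ?addr_ge0//.
  exact: sumr_ge0.
- have M0 : 0 <= M.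
    by have := FM (S (t 0%N)) (ex_intro _ 0%N erefl) 0; rewrite linear0 normr0; apply.
  have := tx (Num.truncn M) => -[x]; apply/negP; rewrite -leNgt.
  have [->|x0] := eqVneq x 0; first by rewrite linear0 normr0 mulr0.
  have := FM (S (t (Num.truncn M))) (ex_intro _ _ erefl) (`|x|^-1 *: x).
  rewrite normfZV// lexx => /(_ isT).
  rewrite linearZ normrZ normfV normr_id mulrC ler_pdivrMr ?normr_gt0// => /le_trans.
  by apply; rewrite ler_wpM2r// ltW// truncnS_gt.
Qed.

Lemma c0_bound T : exists2 M, 1 <= M &
  forall t x, 0 <= t <= T -> `|S t x| <= M * `|x|.
Proof.
have [d d0 [M M1 SM]] := c0_bound_near0; case: (S0) => _ _ Sadd _.
have M0 : 0 <= M by exact: le_trans M1.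
have SMk k t x : 0 <= t <= k%:R * d -> `|S t x| <= M ^+ k.+1 * `|x|.
  elim: k t x => [|k IH] t x.
    rewrite mul0r => /andP[t0 t0']; rewrite expr1; apply: SM.
    by rewrite t0 (le_trans t0')// ltW.
  move=> /andP[t0 tk]; have [td|dt] := leP t d.
    rewrite (le_trans (SM _ _ _)) ?t0// ler_wpM2r//.
    by rewrite [leRHS]exprS ler_peMr// exprn_ege1.
  rewrite -(subrK d t) Sadd ?subr_ge0 ?(ltW dt) ?(ltW d0)//.
  rewrite (le_trans (IH _ _ _))//.
    by rewrite subr_ge0 (ltW dt)/= lerBlDr -[X in _ + X]mul1r -mulrDl natr1.
  rewrite [M ^+ k.+2]exprSr -mulrA ler_wpM2l ?exprn_ge0// SM//.
  by rewrite ltW//= lexx.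
exists (M ^+ (Num.truncn (T / d)).+2); first by rewrite exprn_ege1.
move=> t x /andP[t0 tT]; apply: SMk; rewrite t0 (le_trans tT)//.
by rewrite -ler_pdivrMr// ltW// truncnS_gt.
Qed.

(** For u <= v, the semigroup law writes S(v) y - S(u) y as S(u) applied to
   S(v - u) y - y; continuity at 0 and the local bound do the rest. *)
Lemma c0_uniform T y e : 0 < e -> exists2 d, 0 < d &
  forall s t, 0 <= s <= T -> 0 <= t <= T -> `|s - t| <= d ->
  `|S s y - S t y| <= e.
Proof.
have [M M1 SM] := c0_bound T => e0; have M0 : 0 < M by exact: lt_le_trans M1.
have [d d0 hd] := c0_small y (divr_gt0 e0 M0); exists d => // s t.
have main u v : 0 <= u <= T -> 0 <= v <= T -> u <= v -> v - u <= d ->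
    `|S v y - S u y| <= e.
  move=> /andP[u0 uT] _ uv vu; case: (S0) => _ _ Sadd _.
  rewrite -(subrK u v) [_ - _ + _]addrC Sadd// ?subr_ge0// -linearB.
  rewrite (le_trans (SM _ _ _)) ?u0// mulrC -ler_pdivlMr// hd//.
  by rewrite subr_ge0 uv.
move=> sT tT; have [st|/ltW ts] := leP s t.
  by rewrite distrC ger0_norm ?subr_ge0// distrC => h; exact: main.
by rewrite ger0_norm ?subr_ge0// => h; exact: main.
Qed.

Lemma c0_continuous T y : 0 <= T -> continuous (fun s => S (clamp 0 T s) y).
Proof.
move=> T0 s; apply/cvgrPdist_le => e e0.
have [d d0 hd] := c0_uniform T y e0.
have /cvgrPdist_le/(_ _ d0) := @clamp_continuous R 0 T s.
by apply: filterS => t /= h; apply: hd => //; exact: clamp_itv.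
Qed.

End semigroup.

(** * Scalar integrals over intervals *)
Section interval_integrals.
Context {R : realType}.
Notation mu := (@lebesgue_measure R).
Implicit Types (f g : R -> R) (a b c : R).

Lemma continuous_integrable f a b : continuous f ->
  mu.-integrable `[a, b] (EFin \o f).
Proof.
move=> cf; apply: continuous_compact_integrable; first exact: segment_compact.
exact: continuous_subspaceT.
Qed.

Lemma Rintegral_split f a b c : a <= b -> b <= c ->
  mu.-integrable `[a, c] (EFin \o f) ->
  \int[mu]_(s in `[a, c]) f s =
  \int[mu]_(s in `[a, b]) f s + \int[mu]_(s in `[b, c]) f s.
Proof.
move=> ab bc fi.
have fbc : mu.-integrable `[b, c] (EFin \o f).
  by apply: integrableS fi => //; apply: subset_itvr; rewrite bnd_simp.
have := @Rintegral_itvB R f (BLeft a) (BRight c) b fi.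
rewrite !bnd_simp => /(_ ab bc) /eqP; rewrite subr_eq => /eqP ->.
rewrite addrC; congr (_ + _); rewrite Rintegral_itv_obnd_cbnd//.
by apply: integrableS fbc => //; apply: subset_itvr; rewrite bnd_simp.
Qed.

Lemma Rintegral_cst_itv a b k : a <= b ->
  \int[mu]_(s in `[a, b]) k = k * (b - a).
Proof.
move=> ab; rewrite Rintegral_cst//; congr (_ * _).
apply: (etrans (congr1 fine (lebesgue_measure_itv `[a, b]))).
rewrite /= lte_fin; move: ab; rewrite le_eqVlt => /orP[/eqP ->|->//].
by rewrite ltxx subrr.
Qed.

Lemma cst_integrable a b k : mu.-integrable `[a, b] (EFin \o cst k).
Proof. by apply: continuous_integrable => x; exact: cst_continuous. Qed.

Lemma Rintegral_near_cst f a b k e : a <= b ->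
  mu.-integrable `[a, b] (EFin \o f) ->
  (forall s, a <= s <= b -> `|f s - k| <= e) ->
  `|\int[mu]_(s in `[a, b]) f s - (b - a) * k| <= (b - a) * e.
Proof.
move=> ab fi fk.
rewrite [_ * k]mulrC -Rintegral_cst_itv// -RintegralB//; last exact: cst_integrable.
have fki : mu.-integrable `[a, b] (EFin \o (fun s => f s - k)).
  by apply: (integrableB _ fi (cst_integrable a b k)).
rewrite (le_trans (le_normr_Rintegral _ fki))// mulrC -Rintegral_cst_itv//.
apply: le_Rintegral => //.
- by have := integrable_norm fki.
- exact: cst_integrable.
Qed.

Lemma Rintegral_shift f a b c : a <= b -> continuous f ->
  \int[mu]_(s in `[a, b]) f (s + c) = \int[mu]_(s in `[a + c, b + c]) f s.
Proof.
move=> ab cf; rewrite /Rintegral; congr fine.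
have d1 (x : R^o) : is_derive x 1 (fun s : R^o => s + c : R^o) 1.
  by have := is_deriveD (@is_derive_id _ R x 1) (is_derive_cst c x 1); rewrite addr0.
have dF : derive1 (fun s : R^o => s + c : R^o) = cst 1.
  by apply/funext => x; rewrite derive1E derive_val.
have -> := @integration_by_substitution_increasing R (fun s => s + c) f a b ab.
- by apply: eq_integral => x _; rewrite dF/= mulr1.
- by move=> x y _ _ xy; rewrite ltrD2r.
- by rewrite dF => x _; exact: cst_continuous.
- by rewrite dF; apply/cvg_ex; exists 1; exact: cvg_cst.
- by rewrite dF; apply/cvg_ex; exists 1; exact: cvg_cst.
- have cs x : {for x, continuous (fun s : R => s + c)}.
    by apply: cvgD; [exact: cvg_id|exact: cvg_cst].
  split; first by move=> x _; exact: ex_derive.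
  + by apply: cvg_at_right_filter; exact: cs.
  + by apply: cvg_at_left_filter; exact: cs.
- exact: continuous_subspaceT.
Qed.

End interval_integrals.

(** * The adjoint semigroup *)
Section vector_integrals.
Context {R : realType}.
Notation mu := (@lebesgue_measure R).

(** The pointwise integral is linear and, as the curve is bounded,
   continuous. *)
Lemma dual_integral {W : normedModType R} (c : R -> dual W) (a b M : R) :
  a <= b -> (forall w, continuous (fun s => c s w : R)) ->
  (forall s, `|c s| <= M) ->
  exists J : dual W, forall w, J w = \int[mu]_(s in `[a, b]) c s w.
Proof.
move=> ab cc cM.
have ci w : mu.-integrable `[a, b] (EFin \o (fun s => c s w)).
  exact: continuous_integrable.
apply: (@dual_of_bounded _ _ (fun w => \int[mu]_(s in `[a, b]) c s w) ((b - a) * M)).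
  move=> k x y.
  have kci : mu.-integrable `[a, b] (EFin \o (fun s => k * c s x)).
    by apply: continuous_integrable => s; apply: cvgMr; exact: cc.
  rewrite -RintegralZl// -RintegralD//.
  by apply: eq_Rintegral => s _; rewrite linearP.
move=> w; have := @Rintegral_near_cst R (fun s => c s w) a b 0 (M * `|w|) ab (ci w).
rewrite mulr0 subr0 -mulrA; apply => s _; rewrite subr0.
by rewrite (le_trans (dual_le _ _))// ler_wpM2r.
Qed.

Lemma evaluation_exists {W : normedModType R} (w : W) :
  exists P : dual (dual W), forall p, P p = p w.
Proof.
apply: (@dual_of_bounded _ _ (fun p : dual W => p w) `|w|) => [//|p].
by rewrite mulrC dual_le.
Qed.

Definition evaluation {W : normedModType R} (w : W) : dual (dual W) :=
  sval (cid (evaluation_exists w)).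

Lemma evaluationE {W : normedModType R} (w : W) (p : dual W) :
  evaluation w p = p w.
Proof. by rewrite /evaluation; case: cid. Qed.

Lemma evaluation_norm {W : normedModType R} (w : W) : `|evaluation w| <= `|w|.
Proof.
apply: dual_norm_le_bound => // p.
by rewrite evaluationE mulrC dual_le.
Qed.

(** Weak (Pettis) integrability of the orbits; the mean of an orbit over a short
   interval is the standard element of the domain of the generator. *)
Definition has_orbit_integrals {V : normedModType R} (S : R -> {linear V -> V}) :=
  forall y h, 0 < h -> exists J, forall p : dual V,
    p J = \int[mu]_(s in `[0, h]) p (S s y).

(** Evaluation embeds the orbit in the bidual, where it has a pointwise
   integral; reflexivity brings this integral back. *)
Lemma orbit_integrals_reflexive {V : completeNormedModType R}
    (S : R -> {linear V -> V}) :
  reflexive_space V -> c0_semigroup S -> has_orbit_integrals S.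
Proof.
move=> rV c0 y h h0; have [M _ SM] := c0_bound c0 h.
have [||//|J JE] := @dual_integral (dual V) (fun s => evaluation (S (clamp 0 h s) y)) 0 h
  (M * `|y|).
- exact: ltW.
- move=> p.
  rewrite (_ : (fun s => _) = (fun s => p (S (clamp 0 h s) y))); last first.
    by apply/funext => s; rewrite evaluationE.
  exact: (dual_comp_continuous (c0_continuous c0 (ltW h0))).
- move=> s; rewrite (le_trans (evaluation_norm _))// SM//.
  by rewrite clamp_itv// ltW.
have [w wE] := rV J; exists w => p; rewrite -wE JE.
apply: eq_Rintegral => s; rewrite inE/= in_itv/= => sh.
by rewrite evaluationE clamp_id.
Qed.

(** The pointwise integral of the orbit is tested here against the bidual,
   which by reflexivity consists of evaluations. *)
Lemma orbit_integrals_dual {V : completeNormedModType R}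
    (Sd : R -> {linear dual V -> dual V}) :
  reflexive_space V -> c0_semigroup Sd -> has_orbit_integrals Sd.
Proof.
move=> rV c0 q h h0; have [M _ SM] := @c0_bound R (dual V) _ c0 h.
have [||//|J JE] := @dual_integral V (fun s => Sd (clamp 0 h s) q) 0 h
  (M * `|q|).
- exact: ltW.
- move=> y.
  rewrite (_ : (fun s => _) = (fun s => evaluation y (Sd (clamp 0 h s) q))).
    2: by apply/funext => s; rewrite evaluationE.
  exact: (dual_comp_continuous (@c0_continuous R (dual V) _ c0 h q (ltW h0))).
- by move=> s; rewrite SM// clamp_itv// ltW.
exists J => P; have [y yE] := rV P; rewrite yE JE.
apply: eq_Rintegral => s; rewrite inE/= in_itv/= => sh.
by rewrite yE clamp_id.
Qed.

End vector_integrals.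

Section generator.
Context {R : realType} {V : completeNormedModType R}.
Variables (A : set (V * V)) (S : R -> {linear V -> V}).
Hypothesis gS : generates A S.
Notation mu := (@lebesgue_measure R).

Lemma norm_le_of_dual (x : V) r : 0 <= r ->
  (forall p : dual V, (forall y, `|p y| <= `|y|) -> p x <= r) -> `|x| <= r.
Proof.
move=> r0 h; have [p p1 px] := norming_functional x.
by rewrite -px h.
Qed.

(** Let J be the integral of the orbit of [y] over [0, h].  The mean J/h is
   close to [y] for small h.  It is in the domain: S(tau) J - J is the
   difference of the integrals over [h, h + tau] and [0, tau], so its quotient
   by tau converges to S(h) y - y. *)
Lemma generates_domain_dense : has_orbit_integrals S ->
  forall y e, 0 < e -> exists y' w, A (y', w) /\ `|y' - y| <= e.
Proof.
case: gS => c0 AP HI y e e0.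
have [h h0 hS] := c0_small c0 y e0.
have [J JE] := HI y h h0.
have h0' := ltW h0.
have hn0 : h != 0 by rewrite gt_eqF.
(* The extra unit of time leaves room for the shift by tau <= 1 below. *)
pose c s := S (clamp 0 (h + 1) s) y.
have B0 : 0 <= h + 1 by rewrite addr_ge0.
have cc (p : dual V) : continuous (fun s => p (c s) : R).
  exact: (dual_comp_continuous (c0_continuous c0 B0)).
have cE s : 0 <= s <= h + 1 -> c s = S s y by move=> sB; rewrite /c clamp_id.
have JcE (p : dual V) : p J = \int[mu]_(s in `[0, h]) p (c s).
  rewrite JE; apply: eq_Rintegral => s; rewrite inE/= in_itv/= => /andP[s0 sh].
  by rewrite cE// s0 (le_trans sh)// lerDl.
(* The sign is that of the convention that [A] generates exp(-tA). *)
exists (h^-1 *: J), (- (h^-1 *: (S h y - y))); split; last first.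
  have -> : h^-1 *: J - y = h^-1 *: (J - h *: y).
    by rewrite scalerBr scalerA mulVf// scale1r.
  rewrite normrZ gtr0_norm ?invr_gt0// mulrC ler_pdivrMr//.
  apply: norm_le_of_dual => [|p p1]; first exact: mulr_ge0 (ltW e0) h0'.
  rewrite linearB linearZ/= JcE mulrC.
  have := @Rintegral_near_cst R (fun s => p (c s)) 0 h (p y) e h0'
    (continuous_integrable _ _ (cc p)).
  rewrite subr0 => hh; apply: (le_trans (ler_norm _)); apply: hh => s /andP[s0 sh].
  rewrite cE ?s0 ?(le_trans sh) ?lerDl// -linearB (le_trans (p1 _))//.
  by rewrite hS// s0.
apply/AP; apply/cvgrPdist_le => eps eps0.
have eps'0 : 0 < eps * h / 2 by rewrite divr_gt0// mulr_gt0.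
have [d d0 dS] := c0_uniform c0 (h + 1) y eps'0.
near=> tau.
have t0 : 0 < tau by [].
have tn0 : tau != 0 by rewrite gt_eqF.
have td : tau <= d by near: tau; exact: nbhs_right_le.
have th : tau <= h by near: tau; exact: nbhs_right_le.
have t1 : tau <= 1 by near: tau; exact: nbhs_right_le.
have t0' := ltW t0.
have hth : h <= h + tau by rewrite lerDl.
have est : `|S tau J - J - tau *: (S h y - y)| <= tau * (eps * h).
  apply: norm_le_of_dual => [|p p1]; first by rewrite !mulr_ge0// ltW.
  have St : continuous (S tau) by case: c0 => cS _ _ _; exact: cS.
  have pSt : p (S tau J) = \int[mu]_(s in `[tau, h + tau]) p (c s).
    rewrite -[p (S tau J)]/(adjoint St p J) JE.
    have := Rintegral_shift tau h0' (cc p); rewrite add0r => <-.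
    apply: eq_Rintegral => s; rewrite inE/= in_itv/= => /andP[s0 sh].
    rewrite cE ?addr_ge0 ?lerD// addrC.
    by case: c0 => _ _ -> .
  (* The integral over [0, h + tau] is cut at tau and at h; the difference of
     the two decompositions expresses p (S tau J - J). *)
  have split1 := @Rintegral_split R (fun s => p (c s)) 0 tau (h + tau) t0'
    (ler_wpDl h0' (lexx tau)) (continuous_integrable _ _ (cc p)).
  have split2 := @Rintegral_split R (fun s => p (c s)) 0 h (h + tau) h0' hth
    (continuous_integrable _ _ (cc p)).
  have n1 : `|\int[mu]_(s in `[h, h + tau]) p (c s) - (h + tau - h) * p (S h y)| <=
    (h + tau - h) * (eps * h / 2).
    apply: Rintegral_near_cst => //; first exact: continuous_integrable.
    move=> s /andP[hs sh].
    have sB : 0 <= s <= h + 1.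
      by rewrite (le_trans h0' hs) (le_trans sh)// lerD2l.
    rewrite cE// -linearB (le_trans (p1 _))// dS//.
      by rewrite h0' lerDl ler01.
    by rewrite ger0_norm ?subr_ge0// (le_trans _ td)// lerBlDl.
  have n2 : `|\int[mu]_(s in `[0, tau]) p (c s) - (tau - 0) * p y| <=
    (tau - 0) * (eps * h / 2).
    apply: Rintegral_near_cst => //; first exact: continuous_integrable.
    move=> s /andP[s0 st].
    have sB : 0 <= s <= h + 1.
      by rewrite s0 (le_trans st)// (le_trans t1)// lerDr.
    rewrite cE// -linearB (le_trans (p1 _))//.
    have y0 : S 0 y = y by case: c0 => _ ->.
    rewrite -[X in _ - X]y0.
    rewrite dS// ?lexx//.
    by rewrite subr0 ger0_norm// (le_trans st).
  rewrite !dual_evalB dual_evalZ dual_evalB pSt JcE.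
  have e1 : h + tau - h = tau by rewrite addrAC subrr add0r.
  move: n1 n2 split1 split2; rewrite e1 subr0 !ler_distl.
  set i1 := Rintegral _ _ _; set i2 := Rintegral _ _ _.
  set i3 := Rintegral _ _ _; set i4 := Rintegral _ _ _; set i5 := Rintegral _ _ _.
  move=> /andP[_ n1] /andP[n2 _] s1 s2; lra.
have -> : - (h^-1 *: (S h y - y)) - - (tau^-1 *: (S tau (h^-1 *: J) - h^-1 *: J)) =
    (tau * h)^-1 *: (S tau J - J - tau *: (S h y - y)).
  have -> : S tau (h^-1 *: J) = h^-1 *: S tau J by rewrite linearZ.
  rewrite opprK -scalerBr scalerA [RHS]scalerBr scalerA invfM addrC.
  by congr (_ - _ *: _); rewrite mulrAC mulVf// mul1r.
rewrite normrZ gtr0_norm ?invr_gt0 ?mulr_gt0// mulrC ler_pdivrMr ?mulr_gt0//.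
by rewrite (le_trans est)// mulrCA.
Unshelve. all: by end_near. Qed.

Lemma generates_taylor y w e : A (y, w) -> 0 < e ->
  exists2 d, 0 < d & forall h, 0 < h <= d -> `|S h y - y + h *: w| <= h * e.
Proof.
move=> /gS.2 /cvgrPdist_le yw e0; have [d /= d0 hd] := yw _ e0.
exists (d / 2); first exact: divr_gt0.
move=> h /andP[h0 hd2].
have hn0 : h != 0 by rewrite gt_eqF.
have -> : S h y - y + h *: w = h *: (w - - (h^-1 *: (S h y - y))).
  by rewrite opprK scalerDr scalerA divff// scale1r addrC.
rewrite normrZ gtr0_norm// ler_pM2l// hd//=.
by rewrite sub0r normrN gtr0_norm// (le_lt_trans hd2)// ltr_pdivrMr// ltr_pMr// ltr1n.
Qed.

Lemma generates_invariant y w s : 0 <= s -> A (y, w) -> A (S s y, S s w).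
Proof.
case: gS => -[cS _ Sadd _] AP s0 /AP yw; apply/AP.
have := cvg_comp _ _ yw (cS s s0 w).
apply: cvg_trans; apply: near_eq_cvg; near=> h.
have h0 : 0 <= h by [].
have e : S s (S h y) = S h (S s y) by rewrite -!Sadd// addrC.
by rewrite /= !(linearN, linearZ)/= linearB e.
Unshelve. all: by end_near. Qed.

End generator.

Section adjoint_semigroup.
Context {R : realType} {V : completeNormedModType R}.
Variables (A : set (V * V)) (S : R -> {linear V -> V}).
Variable (Sd : R -> {linear dual V -> dual V}).
Hypothesis rV : reflexive_space V.
Hypothesis gS : generates A S.
Hypothesis gSd : generates (adjoint_graph A) Sd.

(** Consider a(k) = Sd(t - k h) p (S(k h) y) with h = t/n.  One step changes it
   by terms in S(h) y - y and Sd(h) p - p; their first-order parts - h w and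
   - h r cancel since r and w are related by the adjoint graph, along the
   whole orbits, so the change is o(h) uniformly in k.  Summing n steps shows
   that a(n) - a(0), which is p (S t y) - Sd t p y, is arbitrarily small. *)
Lemma adjoint_semigroup_domain t p r y w : 0 <= t ->
  A (y, w) -> adjoint_graph A (p, r) -> Sd t p y = p (S t y) :> R.
Proof.
move=> t0 yw pr.
have [c0 _] := gS; have [c0d _] := gSd.
have [M M1 SM] := c0_bound c0 t.
have [N N1 SN] := @c0_bound R (dual V) _ c0d t.
have M0 : 0 <= M by exact: le_trans M1.
have N0 : 0 <= N by exact: le_trans N1.
suff H e : 0 < e -> `|(Sd t p y - p (S t y) : R)| <= t * e * (N * M * (`|p| + `|y|)).
  apply/eqP; rewrite -subr_eq0 -normr_le0; apply/ler_addgt0Pl => e e0.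
  rewrite addr0.
  pose K := t * (N * M * (`|p| + `|y|)) + 1.
  have K0 : 0 < K by rewrite ltr_wpDl// !mulr_ge0// addr_ge0.
  apply: (le_trans (H _ (divr_gt0 e0 K0))).
  rewrite mulrAC [leLHS]mulrC -[leRHS](divfK (lt0r_neq0 K0)) ler_wpM2l//.
    by rewrite divr_ge0 ?ltW.
  by rewrite /K lerDl.
move=> e0; move: (t0); rewrite le_eqVlt => /orP[/eqP <-|t_gt0].
  case: c0 c0d => _ S_0 _ _ [_ Sd_0 _ _].
  by rewrite S_0 Sd_0 subrr normr0 !mul0r.
have [d1 d10 T1] := generates_taylor gS yw e0.
have [d2 d20 T2] := @generates_taylor R (dual V) _ _ gSd p r e pr e0.
pose d := Num.min d1 d2.
have d0 : 0 < d by rewrite lt_min d10.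
pose n := (Num.truncn (t / d)).+1.
have n0 : (0 : R) < n%:R by rewrite ltr0n.
pose h := t / n%:R.
have h0 : 0 < h by rewrite divr_gt0.
have nh : n%:R * h = t by rewrite mulrC divfK ?gt_eqF.
have hd : h <= d.
  rewrite ler_pdivrMr// mulrC -ler_pdivrMr// ltW//; exact: truncnS_gt.
have hd1 : 0 < h <= d1 by rewrite h0 (le_trans hd)// ge_min lexx.
have hd2 : 0 < h <= d2 by rewrite h0 (le_trans hd)// ge_min lexx orbT.
pose C := N * M * (`|p| + `|y|).
have step u v : 0 <= u <= t -> 0 <= v <= t ->
    `|(Sd u p (S (v + h) y) - Sd (u + h) p (S v y) : R)| <= h * e * C.
  move=> ut vt.
  have /andP[u0 _] := ut; have /andP[v0 _] := vt.
  have h0' := ltW h0.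
  have -> : S (v + h) y = S v (S h y) by case: c0 => _ _ ->.
  have -> : Sd (u + h) p = Sd u (Sd h p) by case: c0d => _ _ ->.
  have E : Sd u p (S v w) = Sd u r (S v y) :> R.
    have yw' := generates_invariant gS v0 yw.
    have pr' := @generates_invariant R (dual V) _ _ gSd _ _ _ u0 pr.
    exact: (pr' _ _ yw').
  have -> : Sd u p (S v (S h y)) - Sd u (Sd h p) (S v y) =
      Sd u p (S v (S h y - y + h *: w)) - Sd u (Sd h p - p + h *: r) (S v y) :> R.
    have -> : S v (S h y - y + h *: w) = S v (S h y) - S v y + h *: S v w.
      by rewrite linearD linearB linearZ.
    have -> : Sd u (Sd h p - p + h *: r) = Sd u (Sd h p) - Sd u p + h *: Sd u r.
      by rewrite linearD linearB linearZ.
    rewrite dual_evalD dual_evalB dual_evalZ dualDE dualBE dualZE.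
    by rewrite E; lra.
  rewrite (le_trans (ler_normB _ _))//.
  have -> : h * e * C = h * e * (N * M * `|p|) + h * e * (N * M * `|y|).
    by rewrite /C !mulrDr.
  rewrite lerD// (le_trans (dual_le _ _))//.
    rewrite [leRHS](_ : _ = N * `|p| * (M * (h * e))); last by lra.
    apply: ler_pM => //; first exact: SN.
    by rewrite (le_trans (SM _ _ vt))// ler_wpM2l// T1.
  rewrite [leRHS](_ : _ = N * (h * e) * (M * `|y|)); last by lra.
  apply: ler_pM => //; last exact: SM.
  by rewrite (le_trans (SN _ _ ut))// ler_wpM2l// T2.
pose a k : R := Sd (t - k%:R * h) p (S (k%:R * h) y).
have tele k : (k <= n)%N -> `|a k - a 0%N| <= k%:R * (h * e * C).
  elim: k => [_|k IH kn]; first by rewrite subrr normr0 mul0r.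
  have kh : k.+1%:R * h = k%:R * h + h by rewrite -natr1 mulrDl mul1r.
  have kht : k.+1%:R * h <= t by rewrite -nh ler_pM2r// ler_nat.
  have kh0 : 0 <= k%:R * h by rewrite mulr_ge0// ltW.
  rewrite -(subrKA (a k)) (le_trans (ler_normD _ _))//.
  rewrite -natr1 mulrDl mul1r addrC lerD//; first by apply: IH; exact: ltnW.
  have eu : t - k%:R * h = t - k.+1%:R * h + h by rewrite kh; lra.
  rewrite /a eu [in S (k.+1%:R * h)]kh; apply: step; apply/andP; split => //.
  - by rewrite subr_ge0.
  - by rewrite lerBlDr lerDl mulr_ge0// ltW.
  - by rewrite (le_trans _ kht)// kh lerDl ltW.
have := tele n (leqnn n); rewrite /a nh subrr mul0r subr0 distrC.
have -> : Sd 0 p = p by case: c0d => _ ->.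
have -> : S 0 y = y by case: c0 => _ ->.
move=> /le_trans; apply.
by rewrite -[X in _ <= X * e * _]nh -/C !mulrA.
Qed.

(** Both sides are continuous in [p] and in [y], and the two domains are
   dense. *)
Lemma adjoint_semigroupE t p y : 0 <= t -> Sd t p y = p (S t y) :> R.
Proof.
move=> t0; have [c0 _] := gS; have [c0d _] := gSd.
have HI := orbit_integrals_reflexive rV c0.
have HId := orbit_integrals_dual rV c0d.
have [M M1 SM] := c0_bound c0 t.
have [N N1 SN] := @c0_bound R (dual V) _ c0d t.
have tt : 0 <= t <= t by rewrite t0 lexx.
have M0 : 0 <= M by exact: le_trans M1.
have N0 : 0 <= N by exact: le_trans N1.
have small (x K : R) : 0 <= K -> (forall e, 0 < e -> `|x| <= K * e) -> x = 0.
  move=> K0 h; apply/eqP; rewrite -normr_le0; apply/ler_addgt0Pl => e e0.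
  have K1 : 0 < K + 1 by rewrite ltr_wpDl.
  rewrite addr0 (le_trans (h _ (divr_gt0 e0 K1)))// mulrCA ler_piMr//.
    exact: ltW.
  by rewrite ler_pdivrMr// mul1r lerDl.
have dom p1 r y1 : adjoint_graph A (p1, r) -> Sd t p1 y1 = p1 (S t y1) :> R.
  move=> pr; apply/eqP; rewrite -subr_eq0; apply/eqP.
  apply: (small _ (N * `|p1| + `|p1| * M)); first by rewrite addr_ge0// mulr_ge0.
  move=> e e0; have [y' [w [yw ye]]] := generates_domain_dense gS HI y1 e0.
  have -> : Sd t p1 y1 - p1 (S t y1) = p1 (S t (y' - y1)) - Sd t p1 (y' - y1) :> R.
    by rewrite linearB !dual_evalB (adjoint_semigroup_domain t0 yw pr); lra.
  rewrite (le_trans (ler_normB _ _))// mulrDl addrC lerD//.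
    by rewrite (le_trans (dual_le _ _))// ler_pM// SN.
  by rewrite (le_trans (dual_le _ _))// -mulrA ler_wpM2l// (le_trans (SM _ _ tt))// ler_wpM2l.
apply/eqP; rewrite -subr_eq0; apply/eqP.
apply: (small _ (N * `|y| + M * `|y|)); first by rewrite addr_ge0// mulr_ge0.
move=> e e0.
have [p' [r [pr pe]]] := @generates_domain_dense R (dual V) _ _ gSd HId p e e0.
have -> : Sd t p y - p (S t y) = (p' - p) (S t y) - Sd t (p' - p) y :> R.
  rewrite linearB !dualBE (dom _ _ _ pr); lra.
rewrite (le_trans (ler_normB _ _))// mulrDl addrC lerD//.
  rewrite (le_trans (dual_le _ _))// mulrAC ler_pM// (le_trans (SN _ _ tt))//.
  by rewrite ler_wpM2l.
by rewrite (le_trans (dual_le _ _))// mulrC ler_pM// SM.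
Qed.

End adjoint_semigroup.

(** * Measurability of vector-valued functions *)
Section caratheodory.
Context {R : realType} {d : measure_display} {X : measurableType d}.
Implicit Types (D : set X).

(** Superposition measurability: substituting [g] in any Caratheodory integrand
   (measurable in x, continuous in v) leaves a measurable function.  Since
   freezing part of the variables of a Caratheodory integrand yields another
   one, the property passes to sums, multiples, continuous images and pairings
   without new approximations, on product spaces as well as on the line. *)
Definition superposable {V : normedModType R} D (g : X -> V) : Prop :=
  forall G : X -> V -> R, (forall v, measurable_fun D (G ^~ v)) ->
    (forall x, D x -> continuous (G x)) -> measurable_fun D (fun x => G x (g x)).

(** For a countably valued [s n], the substitution is measurable piece by
   piece; the continuity of the integrand passes to the limit. *)
Lemma superposable_limit {V : normedModType R} D (g : X -> V)
    (s : nat -> X -> V) (e : nat -> nat -> V) : measurable D ->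
  (forall n x, D x -> exists k : nat, s n x = e n k) ->
  (forall n k, measurable (D `&` s n @^-1` [set e n k])) ->
  (forall x, D x -> s n x @[n --> \oo] --> g x) ->
  superposable D g.
Proof.
move=> mD se ms sg G mG cG.
apply: (@measurable_fun_cvg _ _ _ D (fun n x => G x (s n x))); last first.
  by move=> x Dx; apply: (cvg_comp _ _ (sg x Dx)); exact: cG.
move=> n _ Y mY.
rewrite (_ : _ `&` _ = \bigcup_k ((D `&` s n @^-1` [set e n k]) `&`
    (D `&` (G ^~ (e n k)) @^-1` Y))).
  by apply: bigcup_measurable => k _; apply: measurableI => //; exact: mG.
apply/seteqP; split=> x /=.
  by move=> [Dx Yx]; have [k sk] := se n x Dx; exists k => //=; rewrite -sk.
by move=> [k _ /= [[Dx ->] [_ Yx]]].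
Qed.

(** The approximations are the roundings floor((n+1) phi) / (n+1). *)
Lemma measurable_superposable D (phi : X -> R) : measurable D ->
  measurable_fun D phi -> @superposable R^o D phi.
Proof.
move=> mD mphi.
apply: (@superposable_limit R^o D phi
  (fun n x => (Num.floor (n.+1%:R * phi x))%:~R / n.+1%:R)
  (fun n k => (odflt 0 (unpickle k : option int))%:~R / n.+1%:R)) => //.
- move=> n x Dx; exists (pickle (Num.floor (n.+1%:R * phi x))).
  by rewrite pickleK.
- move=> n k; set z := odflt _ _.
  rewrite (_ : _ `&` _ = D `&` phi @^-1` `[z%:~R / n.+1%:R, (z + 1)%:~R / n.+1%:R[).
    exact: mphi.
  have n0 : (0 : R) < n.+1%:R by rewrite ltr0n.
  apply/seteqP; split=> x /= [Dx]; rewrite in_itv/=.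
    move=> /(congr1 ( *%R^~ n.+1%:R)); rewrite !divfK ?gt_eqF// => /intr_inj zE.
    split => //; rewrite ler_pdivrMr// ltr_pdivlMr// mulrC -zE.
    by rewrite ge_floor lt_succ_floor.
  move=> /andP[]; rewrite ler_pdivrMr// ltr_pdivlMr// mulrC => z1 z2.
  by split => //; congr (_%:~R / _); apply: floor_def; rewrite z1 z2.
- move=> x Dx; apply/cvgrPdist_le => e e0; near=> n.
  have n0 : (0 : R) < n.+1%:R by rewrite ltr0n.
  set m := Num.floor _.
  have -> : phi x - m%:~R / n.+1%:R = (n.+1%:R * phi x - m%:~R) / n.+1%:R.
    by rewrite mulrBl [_ * phi x]mulrC mulfK ?gt_eqF.
  rewrite normrM [X in _ * X]gtr0_norm ?invr_gt0// ler_pdivrMr//.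
  rewrite ger0_norm ?subr_ge0 ?ge_floor//.
  have h1 : n.+1%:R * phi x - m%:~R <= 1.
    rewrite lerBlDl; have /ltW := lt_succ_floor (n.+1%:R * phi x).
    by rewrite intrD.
  rewrite (le_trans h1)// mulrC -ler_pdivrMr// div1r.
  near: n; exists (Num.truncn e^-1) => // n /= en.
  by rewrite (le_trans (ltW (truncnS_gt _)))// ler_nat ltnS.
Unshelve. all: by end_near. Qed.

Lemma superposable_continuous {V W : normedModType R} D (g : X -> V) (f : V -> W) :
  continuous f -> superposable D g -> superposable D (f \o g).
Proof.
move=> cf sg G mG cG; apply: (sg (fun x v => G x (f v))) => [v|x Dx v]; first exact: mG.
by apply: (continuous_comp (cf v)); exact: cG.
Qed.

Lemma superposableD {V : normedModType R} D (g h : X -> V) :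
  superposable D g -> superposable D h -> superposable D (fun x => g x + h x).
Proof.
move=> sg sh G mG cG.
apply: (sg (fun x v => G x (v + h x))) => [v|x Dx v].
  apply: (sh (fun x w => G x (v + w))) => [w|x Dx w]; first exact: mG.
  apply: (@continuous_comp _ _ _ (fun w => v + w)); last exact: cG.
  by apply: cvgD; [exact: cvg_cst|exact: cvg_id].
apply: (@continuous_comp _ _ _ (fun v => v + h x)); last exact: cG.
by apply: cvgD; [exact: cvg_id|exact: cvg_cst].
Qed.

Lemma superposableZ {V : normedModType R} D (c : X -> R) (g : X -> V) :
  measurable D -> measurable_fun D c -> superposable D g ->
  superposable D (fun x => c x *: g x).
Proof.
move=> mD mc sg G mG cG.
apply: (sg (fun x v => G x (c x *: v))) => [v|x Dx v].
  apply: (measurable_superposable mD mc (G := fun x (a : R^o) => G x (a *: v))) => [a|x Dx a].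
    exact: mG.
  apply: (@continuous_comp _ _ _ (fun a : R^o => a *: v)); last exact: cG.
  by apply: cvgZr_tmp; exact: cvg_id.
apply: (@continuous_comp _ _ _ (fun v => c x *: v)); last exact: cG.
by apply: cvgZl_tmp; exact: cvg_id.
Qed.

Lemma superposable_eval {V W : normedModType R} D (P : X -> V -> W) (g : X -> V) :
  (forall v, superposable D (P ^~ v)) -> (forall x, D x -> continuous (P x)) ->
  superposable D g -> superposable D (fun x => P x (g x)).
Proof.
move=> sP cP sg G mG cG.
apply: (sg (fun x v => G x (P x v))) => [v|x Dx v]; first exact: sP.
by apply: (continuous_comp (cP x Dx v)); exact: cG.
Qed.

Lemma superposable_norm {V : normedModType R} D (g : X -> V) :
  superposable D g -> measurable_fun D (fun x => `|g x|).
Proof.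
move=> sg; apply: (sg (fun _ v => `|v|)) => [v|x _]; first exact: measurable_cst.
exact: norm_continuous.
Qed.

(** The pairing is substituted one argument at a time: for a fixed functional
   it is continuous in the vector, and conversely. *)
Lemma superposable_pairing {V : normedModType R} D (p : X -> dual V) (g : X -> V) :
  superposable D p -> superposable D g -> measurable_fun D (fun x => p x (g x) : R).
Proof.
move=> sp sg.
apply: (sg (fun x v => p x v)) => [v|x _]; last exact: dual_continuous.
apply: (sp (fun x q => q v)) => [q|x _]; first exact: measurable_cst.
rewrite (_ : (fun q : dual V => _) = evaluation v); first exact: dual_continuous.
by apply/funext => q; rewrite evaluationE.
Qed.

Lemma superposable_dual {V : normedModType R} D (p : dual V) (g : X -> V) :
  superposable D g -> measurable_fun D (fun x => p (g x) : R).
Proof.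
move=> sg; apply: (sg (fun _ v => p v)) => [v|x _]; first exact: measurable_cst.
exact: dual_continuous.
Qed.

Lemma superposable_eq {V : normedModType R} D (g h : X -> V) :
  (forall x, D x -> g x = h x) -> superposable D g -> superposable D h.
Proof.
move=> gh sg G mG cG; apply: (@eq_measurable_fun _ _ _ _ D (fun x => G x (g x))).
  by move=> x; rewrite inE => Dx; rewrite gh.
exact: sg.
Qed.

Lemma continuous_superposable {V : normedModType R} D (c : R -> V) (phi : X -> R) :
  measurable D -> measurable_fun D phi -> continuous c ->
  superposable D (fun x => c (phi x)).
Proof.
move=> mD mphi cc; apply: (@superposable_continuous R^o V D phi c cc).
exact: measurable_superposable.
Qed.

Lemma strongly_measurable_superposable {V : normedModType R} D (a b : R)
    (g : R -> V) (phi : X -> R) : measurable D -> measurable_fun D phi ->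
  (forall x, D x -> a <= phi x <= b) -> strongly_measurable a b g ->
  superposable D (fun x => g (phi x)).
Proof.
move=> mD mphi Dab [s ms sg].
have fr n : exists r : seq V, range (s n) = [set` r] by exact/finite_seqP/fimfunP.
pose r n := sval (cid (fr n)).
have rP n t : s n t \in r n.
  rewrite /r; case: cid => q /= rq.
  by have : range (s n) (s n t) by []; rewrite rq.
apply: (@superposable_limit V D (g \o phi) (fun n x => s n (phi x))
  (fun n k => nth 0 (r n) k)) => //.
- by move=> n x Dx; exists (index (s n (phi x)) (r n)); rewrite nth_index.
- by move=> n k; exact: (mphi mD (s n @^-1` [set nth 0 (r n) k]) (ms n _)).
- by move=> x Dx; apply: sg; exact: Dab.
Qed.

End caratheodory.

(** * Bochner integrals commute with functionals *)
Section weak_integral.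
Context {R : realType} {V : normedModType R}.
Notation mu := (@lebesgue_measure R).
Local Open Scope ereal_scope.

Lemma simple_integral_dual a b (s : {fimfun R >-> V}) (p : dual V) :
  measurable_simple s ->
  mu.-integrable `[a, b] (EFin \o (fun t => p (s t))) /\
  (\int[mu]_(t in `[a, b]) p (s t) = p (simple_integral a b s))%R.
Proof.
move=> ms; have [r ur rE] : exists2 r : seq V, uniq r & range s `<=` [set` r].
  have /finite_seqP[r rE] : finite_set (range s) by exact: fimfunP.
  exists (undup r); first exact: undup_uniq.
  by rewrite rE => x /=; rewrite mem_undup.
have sr t : s t \in r by apply: rE; exists t.
pose A x := `[a, b] `&` s @^-1` [set x].
have mA x : measurable (A x) by apply: measurableI => //; exact: ms.
have Afin x : mu (A x) \is a fin_num.
  rewrite ge0_fin_numE// (@le_lt_trans _ _ (mu `[a, b]))//.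
    by apply: le_measure; [rewrite inE; exact: mA|rewrite inE|move=> y []].
  by rewrite lebesgue_measure_itv/=; case: ifPn => // _; rewrite -EFinB ltry.
have pE t : (p (s t))%:E = \sum_(x <- r) (p x * \1_(s @^-1` [set x]) t)%:E.
  rewrite (bigD1_seq (s t))//= indicE mem_set// mulr1 big1 ?adde0// => x xs.
  by rewrite indicE memNset ?mulr0//= => sx; rewrite sx eqxx in xs.
have ii x : mu.-integrable `[a, b] (EFin \o (fun t => p x * \1_(s @^-1` [set x]) t)%R).
  apply: (@integrableZl _ _ _ mu _ _ (p x) (fun t => (\1_(s @^-1` [set x]) t)%:E)) => //.
  apply: (le_integrable _ _ _ (cst_integrable a b 1)) => //.
    by apply: measurableT_comp => //; apply: measurable_indic; exact: ms.
  move=> t _ /=; rewrite indicE normr1 lee_fin.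
  by case: (_ \in _); rewrite ?normr1 ?normr0.
have si : mu.-integrable `[a, b] (EFin \o (fun t => p (s t))).
  rewrite (_ : _ \o _ = fun t => \sum_(x <- r) (p x * \1_(s @^-1` [set x]) t)%:E).
    by apply: integrable_sum => // x _; exact: ii.
  by apply/funext => t; exact: pE.
split=> //.
rewrite /Rintegral; under eq_integral do rewrite pE.
rewrite integral_sum//.
have -> : simple_integral a b s = (\sum_(x <- r) fine (mu (A x)) *: x)%R.
  rewrite /simple_integral -(@fsbig_widen _ _ _ _ [set` r] setT)//; last first.
    move=> x [_ /= xr]; rewrite (_ : _ `&` _ = set0) ?measure0 ?scale0r//.
    by apply/seteqP; split=> // t [_ /= sx]; apply: xr; rewrite -sx sr.
  by rewrite (@fsbig_fwiden _ _ _ _ r)//; rewrite setDv.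
rewrite linear_sum/= (eq_bigr (fun x => (p x * fine (mu (A x)))%:E)); last first.
  move=> x _; under eq_integral do rewrite EFinM.
  rewrite integralZl//; last first.
    apply: (le_integrable _ _ _ (cst_integrable a b 1)) => //.
      by apply: measurableT_comp => //; apply: measurable_indic; exact: ms.
    move=> t _ /=; rewrite indicE normr1 lee_fin.
    by case: (_ \in _); rewrite ?normr1 ?normr0.
  by rewrite integral_indic ?EFinM ?fineK//; [rewrite setIC|exact: ms].
rewrite sumEFin/=; apply: eq_bigr => x _.
by rewrite linearZ/= mulrC.
Qed.

(** The identity is elementary for simple functions; and the difference of the
   scalar integrals of [p \o g] and [p \o s n] is at most the norm of [p]
   times the integral of the norm of [g - s n]. *)
Lemma bochner_weak a b (g : R -> V) I (p : dual V) :
  has_bochner_integral a b g I ->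
  mu.-integrable `[a, b] (EFin \o (fun t => p (g t))) /\
  (\int[mu]_(t in `[a, b]) p (g t) = p I)%R.
Proof.
move=> [sg [s [ms sL1 sI]]].
have mab : measurable (`[a, b] : set (measurableTypeR R)) by [].
have sup (g' : R -> V) : strongly_measurable a b g' -> superposable (`[a, b] : set (measurableTypeR R)) g'.
  by move=> sg'; apply: (@strongly_measurable_superposable R _ (measurableTypeR R) V `[a, b] a b g' id).
have ss n : strongly_measurable a b (s n).
  by exists (fun _ => s n) => // t _; exact: cvg_cst.
have md n : measurable_fun `[a, b] (fun t => `|g t - s n t|%R).
  apply: superposable_norm; apply: superposableD; first exact: sup.
  apply: (@superposable_continuous _ _ _ V V _ (s n) -%R); last exact: sup.
  exact: opp_continuous.
have mpd n : measurable_fun `[a, b] (fun t => p (g t - s n t)%R).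
  apply: superposable_dual; apply: superposableD; first exact: sup.
  apply: (@superposable_continuous _ _ _ V V _ (s n) -%R); last exact: sup.
  exact: opp_continuous.
have small (e : R) : (0 < e)%R -> exists n,
    [/\ mu.-integrable `[a, b] (EFin \o (fun t => `|g t - s n t|%R)),
    (\int[mu]_(t in `[a, b]) `|g t - s n t| <= e)%R &
    (`|simple_integral a b (s n) - I| <= e)%R].
  move=> e0.
  have [N1 _ h1] : \forall n \near \oo, \int[mu]_(t in `[a, b]) (`|g t - s n t|)%:E < e%:E.
    have h0 : nbhs (0%:E : \bar R) [set x | x < e%:E] by apply: open_ereal_lt'; rewrite lte_fin.
    exact: (sL1 _ h0).
  have /cvgrPdist_le/(_ _ e0) [N2 _ h2] := sI.
  exists (maxn N1 N2).
  have h1' := h1 (maxn N1 N2) (leq_maxl _ _).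
  have ii : mu.-integrable `[a, b] (EFin \o (fun t => `|g t - s (maxn N1 N2) t|%R)).
    apply/integrableP; split; first by apply/measurable_EFinP; exact: md.
    apply: le_lt_trans (lt_trans h1' (ltry e)).
    by under eq_integral do rewrite /= normr_id.
  split=> //; last by rewrite distrC h2//= leq_maxr.
  by rewrite -lee_fin fineK ?integrable_fin_num// ltW.
have pii n : mu.-integrable `[a, b] (EFin \o (fun t => `|g t - s n t|%R)) ->
    mu.-integrable `[a, b] (EFin \o (fun t => p (g t - s n t)%R)).
  move=> ii; apply: (le_integrable _ _ _ (integrableZl _ `|p|%R ii)) => //.
    by apply/measurable_EFinP; exact: mpd.
  by move=> t _; rewrite /= lee_fin normrM !normr_id dual_le.
have gE n : (fun t => p (g t)) = (fun t => p (g t - s n t) + p (s n t))%R.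
  by apply/funext => t; rewrite -dual_evalD subrK.
have pgi : mu.-integrable `[a, b] (EFin \o (fun t => p (g t))).
  have [n [ii _ _]] := small 1%R ltr01; rewrite (gE n).
  exact: (integrableD _ (pii _ ii) (simple_integral_dual a b p (ms n)).1).
split=> //; apply/eqP; rewrite -subr_eq0 -normr_le0; apply/ler_addgt0Pl => e e0.
pose K := (`|p| + `|p| + 1)%R.
have K0 : (0 < K)%R by rewrite ltr_wpDl// addr_ge0.
have [n [ii i1 i2]] := small (e / K)%R (divr_gt0 e0 K0).
have [si sE] := simple_integral_dual a b p (ms n).
rewrite addr0 (gE n) RintegralD//; last exact: pii.
rewrite sE -addrA -dual_evalB (le_trans (ler_normD _ _))//.
have h1 : (`|\int[mu]_(x in `[a, b]) p (g x - s n x)| <= `|p| * (e / K))%R.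
  rewrite (le_trans (le_normr_Rintegral _ (pii _ ii)))//.
  apply: (@le_trans _ _ (\int[mu]_(x in `[a, b]) (`|p| * `|g x - s n x|))%R).
    apply: le_Rintegral => //.
    - by have := integrable_norm (pii _ ii).
    - exact: (integrableZl _ `|p|%R ii).
    - by move=> x _; exact: dual_le.
  by rewrite RintegralZl// ler_wpM2l.
have h2 : (`|p (simple_integral a b (s n) - I)| <= `|p| * (e / K))%R.
  by rewrite (le_trans (dual_le _ _))// ler_wpM2l.
rewrite (le_trans (lerD h1 h2))// -mulrDl mulrCA ler_piMr//; first exact: ltW.
by rewrite ler_pdivrMr// mul1r /K lerDl.
Qed.

End weak_integral.

(** * Gronwall's inequality with an integrable kernel *)
Section bounds.
Context {R : realType}.
Notation mu := (@lebesgue_measure R).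

Lemma within_continuous_postcomp {V W : normedModType R} a b (f : R -> V) (h : V -> W) :
  a <= b -> continuous h -> {within `[a, b], continuous f} ->
  {within `[a, b], continuous (h \o f)}.
Proof.
move=> ab ch /(within_continuous_clamp ab) cf; apply: clamp_within_continuous => s.
by apply: (continuous_comp (cf s)); exact: ch.
Qed.

Lemma within_continuous_bounded {V : normedModType R} a b (f : R -> V) :
  a <= b -> {within `[a, b], continuous f} ->
  exists2 M, 0 <= M & forall s, a <= s <= b -> `|f s| <= M.
Proof.
move=> ab cf.
have cn := @within_continuous_postcomp V R^o a b f Num.norm ab (@norm_continuous _ V) cf.
have [c cab fc] := EVT_max ab cn.
by exists `|f c| => // s sab; apply: fc; rewrite in_itv.
Qed.

Lemma within_continuous_measurable a b (f : R -> R) :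
  {within `[a, b], continuous f} -> measurable_fun `[a, b] f.
Proof. by move=> cf; apply: subspace_continuous_measurable_fun. Qed.

Lemma integrableM_bounded a b (k f : R -> R) M :
  mu.-integrable `[a, b] (EFin \o k) -> measurable_fun `[a, b] f ->
  (forall s, a <= s <= b -> `|f s| <= M) ->
  mu.-integrable `[a, b] (EFin \o (fun s => k s * f s)).
Proof.
move=> ki mf fM; have mab : measurable (`[a, b] : set (measurableTypeR R)) by [].
have [/measurable_EFinP mk _] := integrableP _ _ _ ki.
apply: (le_integrable _ _ _ (integrableZl _ M ki)) => //.
  by apply/measurable_EFinP; apply: measurable_funM.
move=> s; rewrite /= in_itv/= => sab; rewrite lee_fin !normrM mulrC ler_wpM2r//.
by rewrite (le_trans (fM _ sab))// ler_norm.
Qed.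

Lemma integrableM_continuous a b (k f : R -> R) : a <= b ->
  mu.-integrable `[a, b] (EFin \o k) -> {within `[a, b], continuous f} ->
  mu.-integrable `[a, b] (EFin \o (fun s => k s * f s)).
Proof.
move=> ab ki cf; have [M _ fM] := @within_continuous_bounded R^o a b f ab cf.
by apply: integrableM_bounded ki _ fM; exact: within_continuous_measurable.
Qed.

Lemma integrable_subitv a b c d (f : R -> R) : a <= c -> d <= b ->
  mu.-integrable `[a, b] (EFin \o f) -> mu.-integrable `[c, d] (EFin \o f).
Proof.
move=> ac db; apply: integrableS => //.
by apply: subset_itv; rewrite bnd_simp.
Qed.

End bounds.

Section gronwall.
Context {R : realType}.
Notation mu := (@lebesgue_measure R).
Variables (T : R) (k : R -> R).
Hypothesis T0 : 0 <= T.
Hypothesis ki : mu.-integrable `[0, T] (EFin \o k).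
Hypothesis k0 : forall s, 0 <= s <= T -> 0 <= k s.

Let gronwall_upto (tau : R) (G : R) := 0 <= G /\
  forall (phi : R -> R) c, 0 <= c -> {within `[0, T], continuous phi} ->
    (forall t, 0 <= t <= T -> 0 <= phi t) ->
    (forall t, 0 <= t <= T -> phi t <= c + \int[mu]_(s in `[0, t]) (k s * phi s)) ->
  forall t, 0 <= t <= tau -> phi t <= G * c.

(** On [t1, t2] the kernel has integral at most 1/2, so at the maximum point of
   [phi] on [0, t2] the integral beyond [t1] is at most half the maximum and
   is absorbed in the left-hand side; what remains is controlled by the bound
   up to [t1]. *)
Let gronwall_step t1 t2 G : 0 <= t1 -> t1 <= t2 -> t2 <= T ->
  \int[mu]_(s in `[t1, t2]) k s <= 2^-1 ->
  gronwall_upto t1 G -> exists G', gronwall_upto t2 G'.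
Proof.
move=> t10 t12 t2T k12 [G0 hG].
pose K := \int[mu]_(s in `[0, t1]) k s.
have K0 : 0 <= K.
  apply: Rintegral_ge0 => s; rewrite /= in_itv/= => /andP[s0 st].
  by rewrite k0// s0 (le_trans st)// (le_trans t12).
exists (G + 2 * (1 + G * K)); split; first by rewrite addr_ge0 ?mulr_ge0 ?addr_ge0 ?mulr_ge0.
move=> phi c c0 cphi phi0 hphi.
have t20 : 0 <= t2 by exact: le_trans t12.
have cphi2 : {within `[0, t2], continuous phi}.
  by apply: continuous_subspaceW cphi; apply: subset_itv; rewrite bnd_simp.
have [m] := EVT_max t20 cphi2; rewrite in_itv/= => /andP[m0 mt2] mmax.
suff mG : phi m <= (G + 2 * (1 + G * K)) * c.
  by move=> t t02; rewrite (le_trans _ mG)// mmax// in_itv.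
have hG1 := hG _ _ c0 cphi phi0 hphi.
have GK0 : 0 <= 2 * (1 + G * K) * c by rewrite mulr_ge0// mulr_ge0 ?addr_ge0 ?mulr_ge0.
have [mt1|/ltW t1m] := leP m t1.
  rewrite (le_trans (hG1 m _)) ?m0// mulrDl lerDl//.
have mT : m <= T by exact: le_trans t2T.
have kpi : mu.-integrable `[0, m] (EFin \o (fun s => k s * phi s)).
  apply: (@integrable_subitv _ 0 T) => //; exact: integrableM_continuous.
have := hphi m; rewrite m0 mT => /(_ isT); rewrite (Rintegral_split t10 t1m kpi).
have i1 : \int[mu]_(s in `[0, t1]) (k s * phi s) <= K * (G * c).
  rewrite /K -RintegralZr//; last exact: (@integrable_subitv _ 0 T _ _ _ (lexx 0) (le_trans t12 t2T) ki).
  apply: le_Rintegral => //.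
  - exact: (@integrable_subitv _ 0 m).
  - have := integrableZr _ (G * c) (@integrable_subitv _ 0 T _ _ _ (lexx 0) (le_trans t12 t2T) ki).
    by apply.
  - move=> s; rewrite /= in_itv/= => /andP[s0 st]; rewrite ler_wpM2l ?hG1 ?s0//.
    by rewrite k0// s0 (le_trans st)// (le_trans t12).
have ki1m : mu.-integrable `[t1, m] (EFin \o k).
  exact: (@integrable_subitv _ 0 T _ _ _ t10 mT ki).
have i2 : \int[mu]_(s in `[t1, m]) (k s * phi s) <= 2^-1 * phi m.
  apply: (@le_trans _ _ ((\int[mu]_(s in `[t1, m]) k s) * phi m)).
    rewrite -RintegralZr//; apply: le_Rintegral => //.
    - exact: (@integrable_subitv _ 0 m).
    - by have := integrableZr _ (phi m) ki1m; apply.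
    - move=> s; rewrite /= in_itv/= => /andP[s1 sm].
      have s0 := le_trans t10 s1.
      rewrite ler_wpM2l//; first by rewrite k0// s0 (le_trans sm).
      by rewrite mmax// in_itv/= s0 (le_trans sm).
  rewrite ler_wpM2r ?phi0 ?m0//; rewrite (le_trans _ k12)//.
  rewrite (Rintegral_split t1m mt2); last exact: (@integrable_subitv _ 0 T).
  rewrite lerDl; apply: Rintegral_ge0 => s; rewrite /= in_itv/= => /andP[ms st].
  by rewrite k0// (le_trans m0 ms) (le_trans st).
have Gc0 : 0 <= G * c by rewrite mulr_ge0.
set j1 := Rintegral _ _ _ in i1 *; set j2 := Rintegral _ _ _ in i2 *.
move=> h.
have -> : (G + 2 * (1 + G * K)) * c = G * c + 2 * c + 2 * (K * (G * c)) by lra.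
lra.
Qed.

(** Let sig be the supremum of the times up to which some constant works.  By
   continuity of the primitive of [k] at sig, a step of [gronwall_step] starts
   below sig and ends either beyond sig, which is impossible, or at [T]. *)
Lemma gronwall : exists2 G, 0 <= G &
  forall (phi : R -> R) c, 0 <= c -> {within `[0, T], continuous phi} ->
    (forall t, 0 <= t <= T -> 0 <= phi t) ->
    (forall t, 0 <= t <= T -> phi t <= c + \int[mu]_(s in `[0, t]) (k s * phi s)) ->
  forall t, 0 <= t <= T -> phi t <= G * c.
Proof.
pose K t := \int[mu]_(s in `[0, t]) k s.
have cK : continuous (K \o clamp 0 T).
  by apply: within_continuous_clamp => //; exact: parameterized_integral_continuous.
pose E := [set tau | 0 <= tau <= T /\ exists G, gronwall_upto tau G].
have E0 : E 0.
  split; first by rewrite lexx.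
  exists 1; split => // phi c c0 _ _ hphi t /andP[t0 t0'].
  have -> : t = 0 by apply/eqP; rewrite eq_le t0 t0'.
  by rewrite mul1r (le_trans (hphi _ _)) ?lexx ?T0// set_itv1 Rintegral_set1 addr0.
have hE : has_sup E by split; [exists 0|exists T => t [/andP[]]].
pose sig := sup E.
have sigT : sig <= T by apply: ge_sup; [exists 0|move=> t [/andP[]]].
have sig0 : 0 <= sig by exact: (sup_upper_bound hE).
have sigI : 0 <= sig <= T by rewrite sig0.
have e4 : (0 : R) < 4^-1 by rewrite invr_gt0.
have := cK sig => /cvgrPdist_le/(_ _ e4) [d /= d0 hd].
have d20 : 0 < d / 2 by rewrite divr_gt0.
have dd : d / 2 < d by rewrite ltr_pdivrMr// ltr_pMr// ltr1n.
have [t1 [t1I [G1 hG1]] t1s] := sup_adherent d20 hE.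
have t1sig : t1 <= sig by apply: (sup_upper_bound hE); split => //; exists G1.
pose t2 := Num.min T (sig + d / 2).
have st2 : sig <= t2 by rewrite le_min sigT lerDl ltW.
have t2T : t2 <= T by rewrite ge_min lexx.
have [/andP[t10 t1T]] := (t1I, erefl tt) => _.
have t12 : t1 <= t2 by exact: le_trans st2.
have t2I : 0 <= t2 <= T by rewrite t2T andbT (le_trans sig0).
have k12 : \int[mu]_(s in `[t1, t2]) k s <= 2^-1.
  have h1 : `|K sig - K t1| <= 4^-1.
    have := hd t1; rewrite /= !clamp_id//; apply.
    by rewrite ger0_norm ?subr_ge0// (lt_trans _ dd)// ltrBlDr addrC -ltrBlDr.
  have h2 : `|K sig - K t2| <= 4^-1.
    have := hd t2; rewrite /= !clamp_id//; apply.
    rewrite distrC ger0_norm ?subr_ge0// (le_lt_trans _ dd)// lerBlDr addrC.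
    by rewrite ge_min lexx orbT.
  have : K t2 = K t1 + \int[mu]_(s in `[t1, t2]) k s.
    by apply: Rintegral_split => //; exact: (@integrable_subitv _ 0 T).
  move: h1 h2; rewrite !ler_distl; set j := Rintegral _ _ _.
  by move=> /andP[h1 h1'] /andP[h2 h2'] e; lra.
have [G2 hG2] := gronwall_step t10 t12 t2T k12 hG1.
have t2s : t2 <= sig by apply: (sup_upper_bound hE); split => //; exists G2.
have t2E : t2 = T.
  move: t2s; rewrite /t2 ge_min => /orP[Ts|]; last by rewrite gerDl leNgt d20.
  by apply/min_idPl; rewrite (le_trans Ts)// lerDl ltW.
by case: hG2 => G20 hG2; exists G2 => //; rewrite -t2E in hG2 *.
Qed.

End gronwall.

(** * Duality of forward and backward mild solutions *)
Lemma triangle_measurable {R : realType} (T : R) :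
  measurable ([set x | [&& 0 <= x.1, x.1 <= x.2 & x.2 <= T]] :
    set (measurableTypeR R * measurableTypeR R)).
Proof.
pose d1 (x : measurableTypeR R * measurableTypeR R) : R := x.2 - x.1.
have m1 : measurable_fun setT d1.
  by apply: measurable_funB; [exact: measurable_snd|exact: measurable_fst].
rewrite (_ : [set x | _] = (fst @^-1` `[0, +oo[) `&` (d1 @^-1` `[0, +oo[) `&`
    (snd @^-1` `]-oo, T])); last first.
  apply/seteqP; split=> x /=; rewrite /d1 /= !in_itv/= !andbT subr_ge0.
    by case/and3P.
  by case=> -[-> ->] ->.
apply: measurableI; first apply: measurableI.
- by rewrite -[X in measurable X]setTI; apply: measurable_fst.
- by rewrite -[X in measurable X]setTI; apply: m1.
- by rewrite -[X in measurable X]setTI; apply: measurable_snd.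
Qed.

Lemma measurable_convolution {R : realType} {H : completeNormedModType R}
    {d : measure_display} {X : measurableType d} (S : R -> {linear H -> H})
    (T : R) (D : set X) (g : X -> dual H) (k : X -> H) (tau : X -> R) :
  c0_semigroup S -> 0 <= T -> measurable D ->
  superposable D g -> superposable D k -> measurable_fun D tau ->
  (forall x, D x -> 0 <= tau x <= T) ->
  measurable_fun D (fun x => g x (S (tau x) (k x)) : R).
Proof.
move=> c0 T0 mD sg sk mtau tauT.
apply: (superposable_pairing (g := fun x => S (tau x) (k x)) sg).
apply: (@superposable_eq _ _ _ _ D (fun x => S (clamp 0 T (tau x)) (k x))).
  by move=> x Dx; rewrite clamp_id// tauT.
apply: (superposable_eval (P := fun x v => S (clamp 0 T (tau x)) v)) => //.
  move=> v; apply: (continuous_superposable (c := fun r => S (clamp 0 T r) v)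
    (phi := tau)) => //; exact: c0_continuous.
move=> x _; case: c0 => cS _ _ _; apply: cS.
by have /andP[] := clamp_itv (tau x) T0.
Qed.

Section duality.
Context {R : realType} {H : completeNormedModType R}.
Notation mu := (@lebesgue_measure R).
Notation mR := (measurableTypeR R).
Variables (S : R -> {linear H -> H}) (Sd : R -> {linear dual H -> dual H}).
Hypothesis c0 : c0_semigroup S.
Hypothesis SdE : forall t p y, 0 <= t -> Sd t p y = p (S t y) :> R.
Variables (T : R).
Hypothesis T0 : 0 <= T.

Let D : set (mR * mR) := [set x | [&& 0 <= x.1, x.1 <= x.2 & x.2 <= T]].

Let mD : measurable D := triangle_measurable T.

Variables (g : R -> dual H) (k : R -> H) (p : R -> dual H) (y : R -> H).
Variables (pT : dual H) (gam kap : R -> R).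
Hypothesis sg : superposable D (fun x => g x.2).
Hypothesis sk : superposable D (fun x => k x.1).
Hypothesis gami : mu.-integrable `[0, T] (EFin \o gam).
Hypothesis kapi : mu.-integrable `[0, T] (EFin \o kap).
Hypothesis g_le : forall t, 0 <= t <= T -> `|g t| <= gam t.
Hypothesis k_le : forall t, 0 <= t <= T -> `|k t| <= kap t.
Hypothesis yE : forall t (q : dual H), 0 <= t <= T ->
  mu.-integrable `[0, t] (EFin \o (fun s => q (S (t - s) (k s)))) /\
  \int[mu]_(s in `[0, t]) q (S (t - s) (k s)) = q (y t).
Hypothesis pE : forall s (v : H), 0 <= s <= T ->
  mu.-integrable `[s, T] (EFin \o (fun t => Sd (t - s) (g t) v)) /\
  \int[mu]_(t in `[s, T]) Sd (t - s) (g t) v = (p s - Sd (T - s) pT) v.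

Let h (x : mR * mR) : R := g x.2 (S (x.2 - x.1) (k x.1)).
Let F : mR * mR -> \bar R := EFin \o (h \_ D).

Let mF : measurable_fun setT F.
Proof.
have tauD (x : mR * mR) : D x -> 0 <= x.2 - x.1 <= T.
  move=> /and3P[x0 x12 xT]; rewrite subr_ge0 x12/=.
  by rewrite lerBlDr (le_trans xT)// lerDl.
have mt : measurable_fun D (fun x : mR * mR => x.2 - x.1 : R).
  apply: measurable_funTS.
  by apply: measurable_funB; [exact: measurable_snd|exact: measurable_fst].
have mh : measurable_fun D h by exact: (measurable_convolution c0 T0 mD sg sk mt tauD).
by apply/measurable_EFinP; exact: (measurable_restrictT h mD).1.
Qed.

(** The integrand is dominated by the tensor product of the two integrable
   bounds [gam] and [kap]. *)
Let Fint : (mu \x mu)%E.-integrable setT F.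
Proof.
have [M M1 SM] := c0_bound c0 T.
have M0 : 0 <= M by exact: le_trans M1.
apply/integrable12ltyP => //.
have m0T : measurable (`[0, T] : set mR) by [].
pose gr := gam \_ (`[0, T]%classic).
pose kr := kap \_ (`[0, T]%classic).
have gri : mu.-integrable setT (EFin \o gr).
  by move/(integrable_mkcond _ m0T): gami; rewrite restrict_EFin.
have kri : mu.-integrable setT (EFin \o kr).
  by move/(integrable_mkcond _ m0T): kapi; rewrite restrict_EFin.
have bnd s t : (`|F (s, t)| <= (M * `|kr s|)%:E * (`|gr t|)%:E)%E.
  rewrite /F /= /patch; case: ifPn => [|_]; last first.
    by rewrite normr0 -EFinM lee_fin !mulr_ge0.
  rewrite inE => /and3P[/= s0 st tT].
  have sI : 0 <= s <= T by rewrite s0 (le_trans st).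
  have tI : 0 <= t <= T by rewrite (le_trans s0).
  rewrite /kr /gr /patch !mem_set/= ?in_itv//= -EFinM lee_fin /h/=.
  rewrite (le_trans (dual_le _ _))// mulrC ler_pM//.
    rewrite (le_trans (SM _ _ _))//.
      by rewrite subr_ge0 st/= lerBlDr (le_trans tT)// lerDl.
    by rewrite ler_wpM2l// (le_trans (k_le sI))// ler_norm.
  by rewrite (le_trans (g_le tI))// ler_norm.
have mgr : measurable_fun setT (fun t => (`|gr t|)%:E).
  by apply/measurable_EFinP; apply: measurableT_comp => //; apply/measurable_EFinP; case/integrableP: gri.
have mkr : measurable_fun setT (fun t => (`|kr t|)%:E).
  by apply/measurable_EFinP; apply: measurableT_comp => //; apply/measurable_EFinP; case/integrableP: kri.
pose Cg := (\int[mu]_t (`|gr t|)%:E)%E.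
have Cgfin : Cg \is a fin_num.
  rewrite ge0_fin_numE; last by apply: integral_ge0 => t _; rewrite lee_fin.
  by case/integrableP: gri.
have Ckfin : (\int[mu]_t (`|kr t|)%:E < +oo)%E by case/integrableP: kri.
apply: (@le_lt_trans _ _ (\int[mu]_s ((M * fine Cg)%:E * (`|kr s|)%:E))%E).
  apply: ge0_le_integral => //.
  - by move=> s _; apply: integral_ge0.
  - apply: (measurable_fun_fubini_tonelli_F (m2 := mu) (abse \o F)) => //=.
    exact: measurableT_comp.
  - exact: measurable_funeM.
  move=> s _; apply: (@le_trans _ _ (\int[mu]_t ((M * `|kr s|)%:E * (`|gr t|)%:E))%E).
    apply: ge0_le_integral => //.
    - by apply: measurableT_comp => //; exact: measurable_fun_pair2.
    - exact: measurable_funeM.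
  rewrite ge0_integralZl//; first by rewrite -/Cg -(fineK Cgfin) -!EFinM lee_fin mulrAC.
  by rewrite lee_fin mulr_ge0.
rewrite ge0_integralZl//.
  by rewrite lte_mul_pinfty// lee_fin mulr_ge0// fine_ge0// integral_ge0.
by rewrite lee_fin mulr_ge0// fine_ge0// integral_ge0.
Qed.

Let m0T : measurable (`[0, T] : set mR). Proof. by []. Qed.

Let a s : R := (p s - Sd (T - s) pT) (k s).
Let b t : R := g t (y t).

Let inner_t s : (\int[mu]_t F (s, t))%E = ((a \_ `[0, T]) s)%:E.
Proof.
have [sI|sN] := boolP (0 <= s <= T); last first.
  rewrite patchC; last by rewrite inE/= in_itv; exact/negP.
  rewrite (eq_integral (cst 0%E)) ?integral0// => t _; rewrite /F /= /patch ifF//.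
  apply/negbTE; apply: contra sN; rewrite inE /D/= => /and3P[s0 st tT].
  by rewrite s0 (le_trans st).
rewrite patchT; last by rewrite inE/= in_itv.
have /andP[s0 sT] := sI.
  have [pi pe] := pE (k s) sI.
  have mst : measurable (`[s, T] : set mR) by [].
  transitivity (\int[mu]_t (((fun t => Sd (t - s) (g t) (k s) : R) \_ `[s, T]) t)%:E)%E.
    apply: eq_integral => t _; rewrite /F /= /patch.
    have -> : ((s, t) \in D) = (t \in `[s, T]%classic).
      by apply/idP/idP; rewrite !inE /D/= in_itv/= s0.
    case: ifPn => //; rewrite inE/= in_itv/= => /andP[st _].
    by rewrite /h/= SdE// subr_ge0.
  rewrite /a -pe /Rintegral fineK; last exact: integrable_fin_num.
  by rewrite [RHS]integral_mkcond restrict_EFin.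
Qed.

Let inner_s t : (\int[mu]_s F (s, t))%E = ((b \_ `[0, T]) t)%:E.
Proof.
have [tI|tN] := boolP (0 <= t <= T); last first.
  rewrite patchC; last by rewrite inE/= in_itv; exact/negP.
  rewrite (eq_integral (cst 0%E)) ?integral0// => s _; rewrite /F /= /patch ifF//.
  apply/negbTE; apply: contra tN; rewrite inE /D/= => /and3P[s0 st tT].
  by rewrite tT andbT (le_trans s0).
rewrite patchT; last by rewrite inE/= in_itv.
have /andP[t0 tT] := tI.
  have [yi ye] := yE (g t) tI.
  have mst : measurable (`[0, t] : set mR) by [].
  transitivity (\int[mu]_s (((fun s => g t (S (t - s) (k s)) : R) \_ `[0, t]) s)%:E)%E.
    apply: eq_integral => s _; rewrite /F /= /patch.
    have -> // : ((s, t) \in D) = (s \in `[0, t]%classic).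
    by apply/idP/idP; rewrite !inE /D/= in_itv/= tT andbT.
  rewrite /b -ye /Rintegral fineK; last exact: integrable_fin_num.
  by rewrite [RHS]integral_mkcond restrict_EFin.
Qed.

(** Integrating [h] over the triangle first in s gives the pairing of g(t) with
   y(t); integrating first in t, after moving [S] to the other side, gives
   (p(s) - Sd(T - s) pT) (k(s)).  The last term integrates to pT (y(T)). *)
Lemma duality_formula :
  pT (y T) + \int[mu]_(t in `[0, T]) g t (y t) =
  \int[mu]_(s in `[0, T]) p s (k s).
Proof.
have ai : mu.-integrable `[0, T] (EFin \o a).
  apply/(integrable_mkcond _ m0T); rewrite restrict_EFin.
  have := integrable_fubini_F Fint; rewrite /fubini_F.
  by under eq_fun do rewrite inner_t.
have TT : 0 <= T <= T by rewrite T0 lexx.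
have [ci ce] := yE pT TT.
pose c s : R := pT (S (T - s) (k s)).
have pE' s : 0 <= s <= T -> p s (k s) = a s + c s :> R.
  move=> /andP[s0 sT]; rewrite /a /c dualBE SdE ?subr_ge0// subrK//.
have -> : \int[mu]_(s in `[0, T]) p s (k s) = \int[mu]_(s in `[0, T]) (a s + c s).
  by apply: eq_Rintegral => s; rewrite inE/= in_itv/= => sI; rewrite pE'.
rewrite RintegralD// -ce addrC; congr (_ + _).
have := Fubini Fint.
under eq_integral do rewrite inner_t.
under [RHS]eq_integral do rewrite inner_s.
have mk (u : R -> R) : (\int[mu]_(s in `[0%R, T]) (u s)%:E)%E =
    (\int[mu]_s ((u \_ `[0, T])%R s)%:E)%E.
  by rewrite integral_mkcond restrict_EFin.
by rewrite /Rintegral !mk => ->.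
Qed.

End duality.

(** * Truncated admissible directions *)
Section lebesgue_ae.
Context {R : realType}.
Notation mu := (@lebesgue_measure R).
Implicit Types P Q : R -> Prop.

Lemma ae_imply P Q : (forall t, P t -> Q t) ->
  {ae mu, forall t, P t} -> {ae mu, forall t, Q t}.
Proof. by move=> PQ; apply: (@filterS _ _ (ae_filter_ringOfSetsType _)). Qed.

Lemma ae_and P Q : {ae mu, forall t, P t} -> {ae mu, forall t, Q t} ->
  {ae mu, forall t, P t /\ Q t}.
Proof. exact: (@filterI _ _ (ae_filter_ringOfSetsType _)). Qed.

End lebesgue_ae.

Section truncation.
Context {R : realType}.
Notation mu := (@lebesgue_measure R).
Notation mR := (measurableTypeR R).
Variables (T um uM : R) (u v : R -> R).
Hypothesis (uL1 : L1 T u) (vL1 : L1 T v) (um_lt : um < uM).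
Hypothesis u_adm : {ae mu, forall t, 0 <= t <= T -> um <= u t <= uM}.
Hypothesis v_um : {ae mu, forall t, 0 <= t <= T -> u t = um -> 0 <= v t}.
Hypothesis v_uM : {ae mu, forall t, 0 <= t <= T -> u t = uM -> v t <= 0}.

(** The square makes [trunc_size n * v] at most 1/(n+1) on the set where
   [`|v|] is at most n+1. *)
Definition trunc_size (n : nat) : R := (n.+1%:R ^+ 2)^-1.

Lemma trunc_size_gt0 n : 0 < trunc_size n.
Proof. by rewrite invr_gt0 exprn_gt0. Qed.

Lemma trunc_size_le n : trunc_size n <= n.+1%:R^-1.
Proof.
by rewrite lef_pV2 ?posrE ?exprn_gt0// expr2 ler_peMl// ler1n.
Qed.

Lemma trunc_size_le1 n : trunc_size n <= 1.
Proof. by rewrite (le_trans (trunc_size_le n))// invf_le1// ler1n. Qed.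

Definition trunc_set (n : nat) : set mR :=
  [set t | [/\ 0 <= t <= T, `|v t| <= n.+1%:R &
    um <= u t + trunc_size n * v t <= uM]].

Definition truncation (n : nat) (t : R) : R := v t * \1_(trunc_set n) t.

Let m0T : measurable (`[0, T] : set mR). Proof. by []. Qed.

Let mu_ : measurable_fun (`[0, T] : set mR) u.
Proof. by apply/measurable_EFinP; case/integrableP: uL1. Qed.

Let mv_ : measurable_fun (`[0, T] : set mR) v.
Proof. by apply/measurable_EFinP; case/integrableP: vL1. Qed.

Lemma trunc_set_measurable n : measurable (trunc_set n).
Proof.
have m1 : measurable_fun (`[0, T] : set mR) (fun t => u t + trunc_size n * v t).
  by apply: measurable_funD => //; apply: measurable_funM.
rewrite (_ : trunc_set n = (`[0, T] `&` v @^-1` `[- n.+1%:R, n.+1%:R]) `&`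
    (`[0, T] `&` (fun t => u t + trunc_size n * v t) @^-1` `[um, uM])).
  by apply: measurableI; [exact: mv_|exact: m1].
apply/seteqP; split=> t; rewrite /trunc_set/= !in_itv/= -ler_norml.
  by case=> -> -> ->.
by case=> -[-> ->] [_ ->].
Qed.

Lemma truncation_or n t : truncation n t = v t \/ truncation n t = 0.
Proof.
rewrite /truncation indicE; case: (_ \in _); rewrite ?mulr1 ?mulr0; by [left|right].
Qed.

Lemma truncation_norm_le n t : `|truncation n t| <= `|v t|.
Proof. by have [->|->] := truncation_or n t; rewrite ?normr0. Qed.

Lemma truncation_L1 n : L1 T (truncation n).
Proof.
apply: (le_integrable _ _ _ vL1) => //.
  apply/measurable_EFinP; apply: measurable_funM => //.
  by apply: measurable_funTS; apply: measurable_indic; exact: trunc_set_measurable.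
by move=> t _; rewrite /= lee_fin truncation_norm_le.
Qed.

Lemma truncation_small n t : `|trunc_size n * truncation n t| <= n.+1%:R^-1.
Proof.
rewrite /truncation indicE; have [|_] := boolP (_ \in _); last first.
  by rewrite !mulr0 normr0.
rewrite inE => -[_ vn _]; rewrite mulr1 normrM gtr0_norm ?trunc_size_gt0//.
have n0 : (0 : R) < n.+1%:R by rewrite ltr0n.
rewrite /trunc_size expr2 invfM -mulrA ler_piMr// mulrC ler_pdivrMr//.
by rewrite mul1r.
Qed.

Lemma truncation_admissible n :
  {ae mu, forall t, 0 <= t <= T -> um <= u t + trunc_size n * truncation n t <= uM}.
Proof.
apply: ae_imply u_adm => t ut tI.
rewrite /truncation indicE; have [|_] := boolP (_ \in _); last first.
  by rewrite !mulr0 addr0 ut.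
by rewrite inE mulr1 => -[].
Qed.

Lemma trunc_size_cvg0 : trunc_size n @[n --> \oo] --> 0.
Proof.
apply/cvgrPdist_le => e e0; near=> n.
rewrite sub0r normrN gtr0_norm ?trunc_size_gt0// (le_trans (trunc_size_le n))//.
rewrite invf_ple ?posrE//; near: n; exists (Num.truncn e^-1) => // n /= en.
by rewrite (le_trans (ltW (truncnS_gt _)))// ler_nat ltnS.
Unshelve. all: by end_near. Qed.

(** At interior values of [u] both bounds hold for small steps; at u = um the
   lower bound holds because v >= 0 there, and symmetrically at u = uM. *)
Lemma trunc_set_eventually :
  {ae mu, forall t, 0 <= t <= T -> \forall n \near \oo, trunc_set n t}.
Proof.
apply: ae_imply (ae_and u_adm (ae_and v_um v_uM)) => t [ut [vm vM]] tI.
have /andP[utm utM] := ut tI.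
have small (e : R) : 0 < e -> \forall n \near \oo, `|trunc_size n * v t| <= e.
  move=> e0.
  have h : trunc_size n * v t @[n --> \oo] --> 0 * v t.
    by apply: cvgMl; exact: trunc_size_cvg0.
  have /cvgrPdist_le/(_ _ e0) := h; apply: filterS => n.
  by rewrite mul0r sub0r normrN.
have big : \forall n \near \oo, `|v t| <= n.+1%:R.
  exists (Num.truncn `|v t|) => // n /= vn.
  by rewrite (le_trans (ltW (truncnS_gt _)))// ler_nat ltnS.
have lo : \forall n \near \oo, um <= u t + trunc_size n * v t.
  move: utm; rewrite le_eqVlt => /orP[/eqP umt|um_ut].
    near=> n; rewrite -umt lerDl mulr_ge0 ?vm//; last exact/ltW/trunc_size_gt0.
  have := small (u t - um); rewrite subr_gt0 => /(_ um_ut); apply: filterS => n.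
  by rewrite ler_norml => /andP[h _]; lra.
have hi : \forall n \near \oo, u t + trunc_size n * v t <= uM.
  move: utM; rewrite le_eqVlt => /orP[/eqP uMt|ut_uM].
    near=> n; rewrite -uMt gerDl mulr_ge0_le0 ?vM//; exact/ltW/trunc_size_gt0.
  have := small (uM - u t); rewrite subr_gt0 => /(_ ut_uM); apply: filterS => n.
  by rewrite ler_norml => /andP[_ h]; lra.
by apply: filterS3 big lo hi => n h1 h2 h3; split=> //; rewrite h2.
Unshelve. all: by end_near. Qed.

Lemma truncation_cvg_L1 :
  (\int[mu]_(t in `[0, T]) `|truncation n t - v t|) @[n --> \oo] --> 0.
Proof.
have mD n : measurable_fun (`[0, T] : set mR) (truncation n).
  by apply/measurable_EFinP; case/integrableP: (truncation_L1 n).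
have [|||||_ + _] := @dominated_convergence _ mR R mu _ m0T
  (fun n => EFin \o truncation n) (EFin \o v) (fun t => `|(v t)%:E|)%E.
- by move=> n; apply/measurable_EFinP; exact: mD.
- exact/measurable_EFinP.
- apply: ae_imply trunc_set_eventually => t h; rewrite /= in_itv/= => tI.
  apply: cvg_near_cst; apply: filterS (h tI) => n nt /=.
  by rewrite /truncation indicE mem_set// mulr1.
- exact: integrable_norm.
- by apply: nearW => t n _; rewrite /= lee_fin truncation_norm_le.
move=> /fine_cvgP[_]; apply: cvg_trans; apply: near_eq_cvg; near=> n.
by [].
Unshelve. all: by end_near. Qed.

End truncation.

(** * Mild solutions tested against functionals *)
Section mild.
Context {R : realType} {H : completeNormedModType R}.
Notation mu := (@lebesgue_measure R).
Notation mR := (measurableTypeR R).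
Variables (S : R -> {linear H -> H}).
Hypothesis c0 : c0_semigroup S.
Variable T : R.
Hypothesis T0 : 0 <= T.

(** Mild solution of y' + A y = k, y(0) = 0, in the form tested by functionals.
   It is linear in (k, y), whereas linearity of vector-valued integrals would
   require a common refinement of simple approximations. *)
Definition weak_mild (k y : R -> H) : Prop :=
  forall t (q : dual H), 0 <= t <= T ->
  mu.-integrable `[0, t] (EFin \o (fun s => q (S (t - s) (k s)))) /\
  \int[mu]_(s in `[0, t]) q (S (t - s) (k s)) = q (y t).

Lemma mild_solution_weak y0 k y : mild_solution S T y0 k y ->
  weak_mild k (fun t => y t - S t y0).
Proof. by move=> [_ h] t q tT; exact: bochner_weak (h t tT). Qed.

Lemma weak_mild_eq k k' y y' : (forall s, 0 <= s <= T -> k s = k' s) ->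
  (forall s, 0 <= s <= T -> y s = y' s) -> weak_mild k y -> weak_mild k' y'.
Proof.
move=> kk' yy' ky t q tT; have [i e] := ky t q tT; have /andP[t0 tT'] := tT.
have kE s : 0 <= s <= t -> q (S (t - s) (k s)) = q (S (t - s) (k' s)).
  by move=> /andP[s0 st]; rewrite kk'// s0 (le_trans st).
split.
  apply: eq_integrable i => // s; rewrite inE/= in_itv/= => st.
  by rewrite kE.
rewrite -yy'// -e; apply: eq_Rintegral => s; rewrite inE/= in_itv/= => st.
by rewrite kE.
Qed.

Lemma weak_mildB k1 k2 y1 y2 : weak_mild k1 y1 -> weak_mild k2 y2 ->
  weak_mild (fun t => k1 t - k2 t) (fun t => y1 t - y2 t).
Proof.
move=> h1 h2 t q tT; have [i1 e1] := h1 t q tT; have [i2 e2] := h2 t q tT.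
have E s : q (S (t - s) (k1 s - k2 s)) = q (S (t - s) (k1 s)) - q (S (t - s) (k2 s)) :> R.
  by rewrite linearB dual_evalB.
have mt : measurable (`[0, t] : set mR) by [].
split.
  apply: eq_integrable (integrableB mt i1 i2) => // s _.
  by rewrite /= E.
rewrite dual_evalB -e1 -e2 -RintegralB//.
by apply: eq_Rintegral => s _; rewrite E.
Qed.

Lemma weak_mildZ a k y : weak_mild k y ->
  weak_mild (fun t => a *: k t) (fun t => a *: y t).
Proof.
move=> h t q tT; have [i e] := h t q tT.
have E s : q (S (t - s) (a *: k s)) = a * q (S (t - s) (k s)) :> R.
  by rewrite linearZ dual_evalZ.
have mt : measurable (`[0, t] : set mR) by [].
split.
  apply: eq_integrable (integrableZl mt a i) => // s _.
  by rewrite /= E.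
rewrite dual_evalZ -e -RintegralZl//.
by apply: eq_Rintegral => s _; rewrite E.
Qed.

(** Test the equation at time t with a functional that norms y(t): the resulting
   scalar inequality is that of [gronwall], with the kernel [kap] multiplied by
   the bound of the semigroup. *)
Lemma mild_gronwall (kap : R -> R) : mu.-integrable `[0, T] (EFin \o kap) ->
  (forall s, 0 <= s <= T -> 0 <= kap s) ->
  exists2 G, 0 <= G & forall (k y : R -> H) (r : R -> R),
    {within `[0, T], continuous y} -> weak_mild k y ->
    mu.-integrable `[0, T] (EFin \o r) ->
    (forall s, 0 <= s <= T -> 0 <= r s) ->
    (forall s, 0 <= s <= T -> `|k s| <= kap s * `|y s| + r s) ->
  forall t, 0 <= t <= T -> `|y t| <= G * \int[mu]_(s in `[0, T]) r s.
Proof.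
move=> ki kap0; have [M M1 SM] := c0_bound c0 T.
have M0 : 0 <= M by exact: le_trans M1.
have m0T : measurable (`[0, T] : set mR) by [].
have Mki : mu.-integrable `[0, T] (EFin \o (fun s => M * kap s)).
  by apply: eq_integrable (integrableZl m0T M ki).
have Mk0 s : 0 <= s <= T -> 0 <= M * kap s by move=> sT; rewrite mulr_ge0 ?kap0.
have [G G0 hG] := gronwall T0 Mki Mk0.
exists (G * M); first exact: mulr_ge0.
move=> k y r cy ky ri r0 kr t tT.
rewrite -mulrA.
have Ir0 : 0 <= M * \int[mu]_(s in `[0, T]) r s.
  by rewrite mulr_ge0//; apply: Rintegral_ge0 => s; rewrite /= in_itv; exact: r0.
have cny : {within `[0, T], continuous (fun s => `|y s|)}.
  exact: (@within_continuous_postcomp _ H R^o 0 T y Num.norm T0 (@norm_continuous _ H) cy).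
apply: (hG (fun s => `|y s|)) => // {t tT} t tT.
have /andP[t0 tT'] := tT.
have mt : measurable (`[0, t] : set mR) by [].
have [q q1 <-] := norming_functional (y t).
have [i <-] := ky t q tT.
have kyi : mu.-integrable `[0, T] (EFin \o (fun s => M * kap s * `|y s|)).
  exact: integrableM_continuous.
have kyi' := integrable_subitv (lexx 0) tT' kyi.
have ri' := integrable_subitv (lexx 0) tT' ri.
have Mri' : mu.-integrable `[0, t] (EFin \o (fun s => M * r s)).
  by apply: eq_integrable (integrableZl mt M ri').
apply: (@le_trans _ _ (\int[mu]_(s in `[0, t]) (M * r s + M * kap s * `|y s|))).
  apply: le_Rintegral => //.
    by apply: eq_integrable (integrableD mt Mri' kyi').
  move=> s; rewrite /= in_itv/= => /andP[s0 st].
  have sT : 0 <= s <= T by rewrite s0 (le_trans st).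
  rewrite (le_trans (ler_norm _))// (le_trans (q1 _))//.
  rewrite (le_trans (SM _ _ _))//.
    by rewrite subr_ge0 st/= lerBlDr (le_trans tT')// lerDl.
  by rewrite -mulrA -mulrDr ler_wpM2l// addrC kr.
rewrite RintegralD// lerD2r RintegralZl// ler_wpM2l//.
rewrite (Rintegral_split t0 tT' ri) lerDl.
apply: Rintegral_ge0 => s; rewrite /= in_itv/= => /andP[ts sT].
by rewrite r0// (le_trans t0 ts).
Qed.

End mild.

(** * Pullbacks, pairings and integrability *)
Section pullback.
Context {R : realType} {d : measure_display} {X : measurableType d}.
Notation mR := (measurableTypeR R).
Variables (a b : R) (D : set X) (phi : X -> R).
Hypotheses (ab : a <= b) (mD : measurable D) (mphi : measurable_fun D phi).
Hypothesis phiD : forall x, D x -> a <= phi x <= b.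

Lemma superposable_pull {V : normedModType R} (c : R -> V) :
  {within `[a, b], continuous c} -> superposable D (fun x => c (phi x)).
Proof.
move=> /(within_continuous_clamp ab) cc.
apply: (@superposable_eq _ _ _ _ D (fun x => (c \o clamp a b) (phi x))).
  by move=> x Dx; rewrite /= clamp_id// phiD.
exact: continuous_superposable.
Qed.

Lemma measurable_pull (u : R -> R) : measurable_fun (`[a, b] : set mR) u ->
  measurable_fun D (fun x => u (phi x)).
Proof.
move=> mu; apply: (@measurable_comp _ _ _ _ _ _ (`[a, b] : set mR)) mu mphi => //.
by move=> _ [x Dx <-]; rewrite /= in_itv/= phiD.
Qed.

End pullback.

Section scalar_integrability.
Context {R : realType}.
Notation mu := (@lebesgue_measure R).
Notation mR := (measurableTypeR R).

Lemma continuous_pairing {V : normedModType R} (P : R -> dual V) (Y : R -> V) :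
  continuous P -> continuous Y -> continuous (fun s => P s (Y s) : R).
Proof.
move=> cP cY s; apply/cvgrPdist_le => e e0.
have P0 : 0 < `|P s| + 1 by rewrite ltr_wpDl.
have Y0 : 0 < `|Y s| + 1 by rewrite ltr_wpDl.
have e20 : 0 < e / 2 by rewrite divr_gt0.
have /cvgrPdist_le/(_ _ (divr_gt0 e20 Y0)) hP := cP s.
have /cvgrPdist_le/(_ _ (divr_gt0 e20 P0)) hY := cY s.
have /cvgrPdist_le/(_ _ ltr01) hY1 := cY s.
near=> t.
have h1 : `|P s - P t| <= e / 2 / (`|Y s| + 1) by near: t.
have h2 : `|Y s - Y t| <= e / 2 / (`|P s| + 1) by near: t.
have h3 : `|Y s - Y t| <= 1 by near: t.
have -> : P s (Y s) - P t (Y t) = P s (Y s - Y t) + (P s - P t) (Y t) :> R.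
  by rewrite dual_evalB dualBE; lra.
rewrite (le_trans (ler_normD _ _))// [e]splitr lerD//.
  rewrite (le_trans (dual_le _ _))//.
  rewrite (le_trans (ler_wpM2l _ h2))// mulrCA ler_piMr//; first exact: ltW.
  by rewrite ler_pdivrMr// mul1r lerDl.
rewrite (le_trans (dual_le _ _))//.
have h4 : `|Y t| <= `|Y s| + 1.
  by rewrite -[Y t](subrK (Y s)) addrC (le_trans (ler_normD _ _))// lerD2l distrC.
rewrite (le_trans (ler_pM _ _ h1 h4))//.
by rewrite divfK ?gt_eqF.
Unshelve. all: by end_near. Qed.

Lemma within_continuous_pairing {V : normedModType R} a b (P : R -> dual V)
    (Y : R -> V) : a <= b -> {within `[a, b], continuous P} ->
  {within `[a, b], continuous Y} ->
  {within `[a, b], continuous (fun s => P s (Y s) : R)}.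
Proof.
move=> ab /(within_continuous_clamp ab) cP /(within_continuous_clamp ab) cY.
apply: clamp_within_continuous; exact: (continuous_pairing cP cY).
Qed.

Lemma ae_bounded_integrable a b (f : R -> R) C :
  measurable_fun (`[a, b] : set mR) f ->
  {ae mu, forall t, a <= t <= b -> `|f t| <= C} ->
  mu.-integrable `[a, b] (EFin \o f).
Proof.
move=> mf fC; apply/integrableP; split; first by apply/measurable_EFinP.
have [ab|ba] := leP a b; last by rewrite set_itv_ge ?integral_set0// bnd_simp -ltNge.
apply: (@le_lt_trans _ _ (\int[mu]_(t in `[a, b]) (`|C|)%:E)%E).
  apply: ae_ge0_le_integral => //.
  - by apply: measurableT_comp => //; apply/measurable_EFinP.
  - apply: ae_imply fC => t h; rewrite /= in_itv/= => tI.
    by rewrite lee_fin (le_trans (h tI))// ler_norm.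
have /integrableP[_] := cst_integrable a b C.
by under eq_integral do rewrite /=.
Qed.

Lemma continuous_within_integrable a b (f : R -> R) :
  {within `[a, b], continuous f} -> mu.-integrable `[a, b] (EFin \o f).
Proof. by move=> cf; apply: continuous_compact_integrable => //; exact: segment_compact. Qed.

End scalar_integrability.

(** * The exact expansion of the cost *)
Section expansion.
Context {R : realType} {H : completeNormedModType R}.
Notation mu := (@lebesgue_measure R).
Notation mR := (measurableTypeR R).
Variables (T : R) (S : R -> {linear H -> H}) (Sd : R -> {linear dual H -> dual H}).
Hypothesis T0 : 0 <= T.
Hypothesis c0 : c0_semigroup S.
Hypothesis SdE : forall t p y, 0 <= t -> Sd t p y = p (S t y) :> R.
Variables (B1 : H) (B2 : {linear H -> H}) (cB2 : continuous B2).
Variables (Q QT : {linear H -> dual H}) (cQ : continuous Q).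
Hypothesis symQ : forall x y, Q x y = Q y x.
Hypothesis symQT : forall x y, QT x y = QT y x.
Variables (Psid : R -> H) (PsidT : H) (alpha : R).
Hypothesis Psid_Linfty : bochner_Linfty 0 T Psid.
Variables (uh : R -> R) (psi : R -> H) (p : R -> dual H).
Hypothesis uhL1 : L1 T uh.
Hypothesis cpsi : {within `[0, T], continuous psi}.
Hypothesis phP : backward_mild_solution Sd T (QT (psi T - PsidT))
     (fun t => Q (psi t - Psid t) + uh t *: adjoint cB2 (p t)) p.

Let m0T : measurable (`[0, T] : set mR). Proof. by []. Qed.

Let cp : {within `[0, T], continuous p}. Proof. by case: phP. Qed.

Let cB2w (w : R -> H) : {within `[0, T], continuous w} ->
  {within `[0, T], continuous (fun t => B2 (w t))}.
Proof. exact: within_continuous_postcomp. Qed.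

Lemma adjoint_continuous : continuous (adjoint cB2).
Proof.
have [b b0 Bb] := continuous_linear_bound cB2.
apply: (@linear_bound_continuous _ _ _ _ b) => [a q r|q].
  by apply/val_inj/funext => x.
apply: dual_norm_le_bound => [|x]; first by rewrite mulr_ge0// ltW.
rewrite -[adjoint cB2 q x]/(q (B2 x)) (le_trans (dual_le _ _))//.
by rewrite [b * _]mulrC -mulrA ler_wpM2l.
Qed.

Let integrable_pB2 (w : R -> H) (v : R -> R) : L1 T v ->
  {within `[0, T], continuous w} ->
  mu.-integrable `[0, T] (EFin \o (fun t => v t * p t (B2 (w t)))).
Proof.
move=> vL1 cw; apply: integrableM_continuous => //.
by apply: within_continuous_pairing => //; exact: cB2w.
Qed.

Let cB (w : R -> H) : {within `[0, T], continuous w} ->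
  {within `[0, T], continuous (fun t => B1 + B2 (w t))}.
Proof.
move=> cw; apply: (@within_continuous_postcomp _ _ _ _ _ w (fun x => B1 + B2 x)) => //.
by move=> x; apply: cvgD; [exact: cvg_cst|exact: cB2].
Qed.

Let Psid_superposable : superposable (`[0, T] : set mR) Psid.
Proof.
case: Psid_Linfty => sP _.
by apply: (@strongly_measurable_superposable R _ mR H `[0, T] 0 T Psid id).
Qed.

Let cwD (w1 w2 : R -> H) : {within `[0, T], continuous w1} ->
  {within `[0, T], continuous w2} ->
  {within `[0, T], continuous (fun t => w1 t + w2 t)}.
Proof.
move=> /(within_continuous_clamp T0) c1 /(within_continuous_clamp T0) c2.
by apply: clamp_within_continuous => s; apply: cvgD; [exact: c1|exact: c2].
Qed.

Let cwZ (a : R) (w : R -> H) : {within `[0, T], continuous w} ->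
  {within `[0, T], continuous (fun t => a *: w t)}.
Proof.
move=> /(within_continuous_clamp T0) c1.
by apply: clamp_within_continuous => s; apply: cvgZl_tmp; exact: c1.
Qed.

Let cQw (w : R -> H) : {within `[0, T], continuous w} ->
  {within `[0, T], continuous (fun t => Q (w t))}.
Proof. exact: within_continuous_postcomp. Qed.

Let residual_superposable : superposable (`[0, T] : set mR) (fun t => psi t - Psid t).
Proof.
apply: superposableD; last first.
  by apply: (@superposable_continuous _ _ mR H H _ Psid -%R) => //; exact: opp_continuous.
by apply: (@superposable_pull _ _ mR 0 T _ id) => // t; rewrite /= in_itv.
Qed.

Let residual_bound : exists2 C, 0 <= C &
  {ae mu, forall t, 0 <= t <= T -> `|psi t - Psid t| <= C}.
Proof.
have [M M0 hM] := within_continuous_bounded T0 cpsi.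
case: Psid_Linfty => _ [N hN]; exists (M + `|N|); first exact: addr_ge0.
apply: ae_imply hN => t h tI; rewrite (le_trans (ler_normB _ _))// lerD ?hM//.
by rewrite (le_trans (h tI))// ler_norm.
Qed.

Let integrable_Qpairing (w : R -> H) : {within `[0, T], continuous w} ->
  mu.-integrable `[0, T] (EFin \o (fun t => Q (psi t - Psid t) (w t))).
Proof.
move=> cw; have [W W0 hW] := within_continuous_bounded T0 cw.
have [C C0 hC] := residual_bound.
have [c c0' hc] := continuous_linear_bound cQ.
apply: (@ae_bounded_integrable _ 0 T _ (c * C * W)).
  apply: (superposable_pairing (p := fun t => Q (psi t - Psid t))).
    by apply: (@superposable_continuous _ _ mR H _ _ (fun t => psi t - Psid t) Q).
  by apply: (@superposable_pull _ _ mR 0 T _ id) => // t; rewrite /= in_itv.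
apply: ae_imply hC => t h tI; rewrite (le_trans (dual_le _ _))// ler_pM ?hW//.
by rewrite (le_trans (hc _))// ler_pM2l// h.
Qed.

Let integrable_quad_residual :
  mu.-integrable `[0, T] (EFin \o (fun t => quad Q (psi t - Psid t))).
Proof.
have [C C0 hC] := residual_bound.
have [c c0' hc] := continuous_linear_bound cQ.
apply: (@ae_bounded_integrable _ 0 T _ (c * C * C)).
  apply: (superposable_pairing (p := fun t => Q (psi t - Psid t))) => //.
  by apply: (@superposable_continuous _ _ mR H _ _ (fun t => psi t - Psid t) Q).
apply: ae_imply hC => t h tI; rewrite /quad (le_trans (dual_le _ _))// ler_pM ?h//.
by rewrite (le_trans (hc _))// ler_pM2l// h.
Qed.

(** [duality_formula] for [w] and the costate, whose sources are
   k = uh B2 w + v (B1 + B2 (psi + sig w)) and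
   g = Q (psi - Psid) + uh B2^* p; the terms with [uh] are the same on both
   sides and cancel. *)
Lemma tangent_duality (w : R -> H) (v : R -> R) (sig : R) :
  {within `[0, T], continuous w} -> L1 T v ->
  weak_mild S T
    (fun s => uh s *: B2 (w s) + v s *: (B1 + B2 (psi s + sig *: w s))) w ->
  QT (psi T - PsidT) (w T) + \int[mu]_(t in `[0, T]) Q (psi t - Psid t) (w t) =
  \int[mu]_(t in `[0, T]) (v t * p t (B1 + B2 (psi t))) +
  sig * \int[mu]_(t in `[0, T]) (v t * p t (B2 (w t))).
Proof.
move=> cw vL1 kw.
pose g t := Q (psi t - Psid t) + uh t *: adjoint cB2 (p t).
pose k s := uh s *: B2 (w s) + v s *: (B1 + B2 (psi s + sig *: w s)).
have cpw : {within `[0, T], continuous (fun s => B1 + B2 (psi s + sig *: w s))}.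
  by apply: cB; apply: cwD => //; exact: cwZ.
have cap : {within `[0, T], continuous (fun s => adjoint cB2 (p s))}.
  exact: (within_continuous_postcomp T0 adjoint_continuous cp).
have [c c0' hc] := continuous_linear_bound cQ.
have [P P0 hP] := within_continuous_bounded T0 cap.
have [M M0 hM] := within_continuous_bounded T0 cpsi.
have [W W0 hW] := within_continuous_bounded T0 (cB2w cw).
have [K K0 hK] := within_continuous_bounded T0 cpw.
have muh : measurable_fun (`[0, T] : set mR) uh.
  by apply/measurable_EFinP; case/integrableP: uhL1.
have mv : measurable_fun (`[0, T] : set mR) v.
  by apply/measurable_EFinP; case/integrableP: vL1.
pose gam t := c * `|psi t - Psid t| + `|uh t| * P.
pose kap t := `|uh t| * W + `|v t| * K.
have absi (x : R -> R) (C : R) : L1 T x ->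
    mu.-integrable `[0, T] (EFin \o (fun t => `|x t| * C)).
  by move=> xi; apply: eq_integrable (integrableZr m0T C (integrable_norm xi)).
have gami : mu.-integrable `[0, T] (EFin \o gam).
  have resi : mu.-integrable `[0, T] (EFin \o (fun t => `|psi t - Psid t|)).
    have [C _ hC] := residual_bound; apply: (@ae_bounded_integrable _ 0 T _ C).
      exact: superposable_norm.
    by apply: ae_imply hC => t h tI; rewrite normr_id h.
  by apply: eq_integrable (integrableD m0T (integrableZl m0T c resi) (absi uh P uhL1)).
have kapi : mu.-integrable `[0, T] (EFin \o kap).
  by apply: eq_integrable (integrableD m0T (absi uh W uhL1) (absi v K vL1)).
have gle t : 0 <= t <= T -> `|g t| <= gam t.
  move=> tI; rewrite (le_trans (ler_normD _ _))// lerD//.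
  by rewrite normrZ ler_wpM2l// hP.
have kle t : 0 <= t <= T -> `|k t| <= kap t.
  move=> tI; rewrite (le_trans (ler_normD _ _))// lerD// normrZ ler_wpM2l//.
    exact: hW.
  exact: hK.
have pE s (x : H) : 0 <= s <= T ->
    mu.-integrable `[s, T] (EFin \o (fun t => Sd (t - s) (g t) x)) /\
    \int[mu]_(t in `[s, T]) Sd (t - s) (g t) x =
    (p s - Sd (T - s) (QT (psi T - PsidT))) x.
  move=> sI; case: phP => _ /(_ s sI) /(bochner_weak (evaluation x)) [i e].
  rewrite -evaluationE -e; split.
    by apply: eq_integrable i => // t _; rewrite /= evaluationE.
  by apply: eq_Rintegral => t _; rewrite evaluationE.
set D : set (mR * mR) := [set x | [&& 0 <= x.1, x.1 <= x.2 & x.2 <= T]].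
have D1 (x : mR * mR) : D x -> 0 <= x.1 <= T.
  by move=> /and3P[-> x12 xT]; rewrite (le_trans x12).
have D2 (x : mR * mR) : D x -> 0 <= x.2 <= T.
  by move=> /and3P[x0 x12 ->]; rewrite (le_trans x0).
have mD : measurable D by exact: triangle_measurable.
have m1 : measurable_fun D (fun x : mR * mR => x.1 : R).
  by apply: measurable_funTS; exact: measurable_fst.
have m2 : measurable_fun D (fun x : mR * mR => x.2 : R).
  by apply: measurable_funTS; exact: measurable_snd.
have sg : superposable D (fun x => g x.2).
  apply: superposableD.
    apply: (@superposable_continuous _ _ _ H _ _ (fun x : mR * mR => psi x.2 - Psid x.2) Q) => //.
    apply: superposableD; first exact: (superposable_pull T0 mD m2 D2).
    apply: (@superposable_continuous _ _ _ H _ _ (fun x : mR * mR => Psid x.2) -%R).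
      exact: opp_continuous.
    by case: Psid_Linfty => sP _; exact: (strongly_measurable_superposable mD m2 D2).
  apply: superposableZ => //; first exact: (measurable_pull m2 D2 muh).
  exact: (superposable_pull T0 mD m2 D2 cap).
have sk : superposable D (fun x => k x.1).
  apply: superposableD; apply: superposableZ => //.
  - exact: (measurable_pull m1 D1 muh).
  - exact: (superposable_pull T0 mD m1 D1 (cB2w cw)).
  - exact: (measurable_pull m1 D1 mv).
  - exact: (superposable_pull T0 mD m1 D1 cpw).
have := duality_formula c0 SdE T0 sg sk gami kapi gle kle kw pE.
have uhi := integrable_pB2 uhL1 cw.
have vi := integrable_pB2 vL1 cw.
have vBi : mu.-integrable `[0, T] (EFin \o (fun t => v t * p t (B1 + B2 (psi t)))).
  apply: integrableM_continuous => //.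
  by apply: within_continuous_pairing => //; exact: cB.
have svi : mu.-integrable `[0, T] (EFin \o (fun t => sig * (v t * p t (B2 (w t))))).
  by apply: eq_integrable (integrableZl m0T sig vi).
have vsi : mu.-integrable `[0, T] (EFin \o (fun t =>
    v t * p t (B1 + B2 (psi t)) + sig * (v t * p t (B2 (w t))))).
  by apply: eq_integrable (integrableD m0T vBi svi).
have -> : \int[mu]_(t in `[0, T]) g t (w t) =
    \int[mu]_(t in `[0, T]) Q (psi t - Psid t) (w t) +
    \int[mu]_(t in `[0, T]) (uh t * p t (B2 (w t))).
  by rewrite -RintegralD//; exact: integrable_Qpairing.
have -> : \int[mu]_(t in `[0, T]) p t (k t) =
    \int[mu]_(t in `[0, T]) (uh t * p t (B2 (w t))) +
    (\int[mu]_(t in `[0, T]) (v t * p t (B1 + B2 (psi t))) +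
     sig * \int[mu]_(t in `[0, T]) (v t * p t (B2 (w t)))).
  rewrite -RintegralZl// -RintegralD// -RintegralD//.
  apply: eq_Rintegral => t _.
  have -> : k t = uh t *: B2 (w t) + v t *: ((B1 + B2 (psi t)) + sig *: B2 (w t)).
    have e : B2 (psi t + sig *: w t) = B2 (psi t) + sig *: B2 (w t).
      by rewrite linearD linearZ.
    by rewrite /k e addrA.
  set X := B1 + B2 (psi t).
  by rewrite dual_evalD !dual_evalZ dual_evalD dual_evalZ; lra.
set i1 := Rintegral _ _ _; set i2 := Rintegral _ _ _.
set i3 := Rintegral _ _ _; set i4 := Rintegral _ _ _; lra.
Qed.

Let integrable_quad (w : R -> H) : {within `[0, T], continuous w} ->
  mu.-integrable `[0, T] (EFin \o (fun t => quad Q (w t))).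
Proof.
move=> cw; apply: continuous_within_integrable.
by apply: within_continuous_pairing => //; exact: cQw.
Qed.

Lemma second_variation_split (w : R -> H) (v : R -> R) :
  {within `[0, T], continuous w} -> L1 T v ->
  second_variation T Q QT B2 p w v =
  \int[mu]_(t in `[0, T]) quad Q (w t) +
  2 * \int[mu]_(t in `[0, T]) (v t * p t (B2 (w t))) + quad QT (w T).
Proof.
move=> cw vL1; congr (_ + _).
have vi := integrable_pB2 vL1 cw.
have vi2 : mu.-integrable `[0, T] (EFin \o (fun t => 2 * (v t * p t (B2 (w t))))).
  by apply: eq_integrable (integrableZl m0T 2 vi).
rewrite -RintegralZl// -RintegralD//; last exact: integrable_quad.
by apply: eq_Rintegral => t _; rewrite mulrA.
Qed.

(** By symmetry of [Q] and [QT] the cost is a polynomial of degree two in sig for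
   a fixed [w]; [tangent_duality] rewrites its linear part, and the term
   v <p, B2 w> that it produces has the factor sig^2 and completes the second
   variation. *)
Lemma cost_expansion (w : R -> H) (v : R -> R) (sig : R) :
  {within `[0, T], continuous w} -> L1 T v ->
  weak_mild S T
    (fun s => uh s *: B2 (w s) + v s *: (B1 + B2 (psi s + sig *: w s))) w ->
  cost T alpha Q QT Psid PsidT (fun t => uh t + sig * v t)
    (fun t => psi t + sig *: w t) =
  cost T alpha Q QT Psid PsidT uh psi +
  sig * \int[mu]_(t in `[0, T]) (switching alpha B1 B2 p psi t * v t) +
  sig ^+ 2 / 2 * second_variation T Q QT B2 p w v.
Proof.
move=> cw vL1 kw; rewrite second_variation_split// /cost.
have td := tangent_duality cw vL1 kw.
have Qi := integrable_quad cw.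
have Qpi := integrable_Qpairing cw.
have Qri := integrable_quad_residual.
have vBi : mu.-integrable `[0, T] (EFin \o (fun t => v t * p t (B1 + B2 (psi t)))).
  apply: integrableM_continuous => //.
  by apply: within_continuous_pairing => //; exact: cB.
have ->: \int[mu]_(t in `[0, T]) (uh t + sig * v t) =
    \int[mu]_(t in `[0, T]) uh t + sig * \int[mu]_(t in `[0, T]) v t.
  have svi : mu.-integrable `[0, T] (EFin \o (fun t => sig * v t)).
    by apply: eq_integrable (integrableZl m0T sig vL1).
  by rewrite -RintegralZl// -RintegralD.
have ->: \int[mu]_(t in `[0, T]) (switching alpha B1 B2 p psi t * v t) =
    alpha * \int[mu]_(t in `[0, T]) v t +
    \int[mu]_(t in `[0, T]) (v t * p t (B1 + B2 (psi t))).
  have avi : mu.-integrable `[0, T] (EFin \o (fun t => alpha * v t)).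
    by apply: eq_integrable (integrableZl m0T alpha vL1).
  rewrite -RintegralZl// -RintegralD//; apply: eq_Rintegral => t _.
  by rewrite /switching mulrDl [v t * _]mulrC.
have quadE (A : {linear H -> dual H}) x y : (forall x y, A x y = A y x) ->
    quad A (x + sig *: y) = quad A x + (2 * sig * A x y + sig ^+ 2 * quad A y).
  move=> symA; have e : A (x + sig *: y) = A x + sig *: A y.
    by rewrite linearD linearZ.
  rewrite /quad e dualDE dualZE !dual_evalD !dual_evalZ.
  by rewrite (symA y x) expr2; lra.
have ->: \int[mu]_(t in `[0, T]) quad Q (psi t + sig *: w t - Psid t) =
    \int[mu]_(t in `[0, T]) quad Q (psi t - Psid t) +
    (2 * sig * \int[mu]_(t in `[0, T]) Q (psi t - Psid t) (w t) +
     sig ^+ 2 * \int[mu]_(t in `[0, T]) quad Q (w t)).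
  have i1 : mu.-integrable `[0, T] (EFin \o (fun t => 2 * sig * Q (psi t - Psid t) (w t))).
    by apply: eq_integrable (integrableZl m0T (2 * sig) Qpi).
  have i2 : mu.-integrable `[0, T] (EFin \o (fun t => sig ^+ 2 * quad Q (w t))).
    by apply: eq_integrable (integrableZl m0T (sig ^+ 2) Qi).
  have i3 : mu.-integrable `[0, T] (EFin \o (fun t =>
      2 * sig * Q (psi t - Psid t) (w t) + sig ^+ 2 * quad Q (w t))).
    by apply: eq_integrable (integrableD m0T i1 i2).
  rewrite -!RintegralZl// -!RintegralD//; apply: eq_Rintegral => t _.
  by rewrite addrAC quadE.
rewrite [psi T + _ - _]addrAC quadE//; move: td; rewrite expr2.
set i1 := Rintegral _ _ _; set i2 := Rintegral _ _ _.
set i3 := Rintegral _ _ _; set i4 := Rintegral _ _ _.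
set i5 := Rintegral _ _ _; set i6 := Rintegral _ _ _.
set q1 := quad _ _; set q2 := quad _ _; set q3 := QT _ _.
move=> td.
have -> : i1 = i2 + sig * i3 - q3 by rewrite -td; lra.
lra.
Qed.

(** The second variation is quadratic in [w] and bilinear in (v, w), so on
   bounded sets it is Lipschitz for the uniform distance of [w] and the L^1
   distance of [v]. *)
Lemma second_variation_close (z : R -> H) (v : R -> R) (W : R) :
  continuous QT -> {within `[0, T], continuous z} -> L1 T v -> 0 <= W ->
  exists2 C, 0 <= C & forall (w : R -> H) (v' : R -> R) e,
    {within `[0, T], continuous w} -> L1 T v' -> 0 <= e ->
    (forall t, 0 <= t <= T -> `|z t| <= W) ->
    (forall t, 0 <= t <= T -> `|w t| <= W) ->
    (forall t, 0 <= t <= T -> `|w t - z t| <= e) ->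
  second_variation T Q QT B2 p w v' <= second_variation T Q QT B2 p z v +
    C * (e + \int[mu]_(t in `[0, T]) `|v' t - v t|).
Proof.
move=> cQT cz vL1 W0.
have [c c0' hc] := continuous_linear_bound cQ.
have [cT cT0' hcT] := continuous_linear_bound cQT.
have cap : {within `[0, T], continuous (fun s => adjoint cB2 (p s))}.
  exact: (within_continuous_postcomp T0 adjoint_continuous cp).
have [P P0 hP] := within_continuous_bounded T0 cap.
have hPB t x : 0 <= t <= T -> `|p t (B2 x)| <= P * `|x|.
  move=> tI; rewrite -[p t (B2 x)]/(adjoint cB2 (p t) x) (le_trans (dual_le _ _))//.
  by rewrite ler_wpM2r// hP.
pose V := \int[mu]_(t in `[0, T]) `|v t|.
have V0 : 0 <= V by apply: Rintegral_ge0.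
have quad_close (A : {linear H -> dual H}) a x y e : 0 <= a -> 0 <= e ->
    (forall x, `|A x| <= a * `|x|) -> `|x| <= W -> `|y| <= W -> `|y - x| <= e ->
    quad A y <= quad A x + 2 * a * W * e.
  move=> a0 e0 hA xW yW xye.
  have -> : quad A y = quad A x + (A (y - x) y + A x (y - x)).
    have e' : A (y - x) = A y - A x by rewrite linearB.
    by rewrite /quad e' dualBE dual_evalB; lra.
  rewrite lerD2l [leRHS](_ : _ = a * e * W + a * W * e); last by lra.
  rewrite lerD// (le_trans (ler_norm _))// (le_trans (dual_le _ _))// ler_pM//.
    by rewrite (le_trans (hA _))// ler_wpM2l.
  by rewrite (le_trans (hA _))// ler_wpM2l.
exists (T * (2 * c * W) + 2 * P * W + 2 * P * V + 2 * cT * W).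
  by rewrite !addr_ge0// !mulr_ge0// ltW.
move=> w v' e cw v'L1 e0 zW wW wz.
pose tau := \int[mu]_(t in `[0, T]) `|v' t - v t|.
have tau0 : 0 <= tau by apply: Rintegral_ge0.
have dvi : mu.-integrable `[0, T] (EFin \o (fun t => `|v' t - v t|)).
  have h : mu.-integrable `[0, T] (EFin \o (fun t => v' t - v t)).
    by apply: eq_integrable (integrableB m0T v'L1 vL1).
  by have := integrable_norm h.
have avi : mu.-integrable `[0, T] (EFin \o (fun t => `|v t|)).
  by have := integrable_norm vL1.
rewrite !second_variation_split//.
have TT : 0 <= T <= T by rewrite T0 lexx.
have h1 : quad QT (w T) <= quad QT (z T) + 2 * cT * W * e.
  apply: quad_close => //; [exact: ltW|exact: zW|exact: wW|exact: wz].
have h2 : \int[mu]_(t in `[0, T]) quad Q (w t) <=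
    \int[mu]_(t in `[0, T]) quad Q (z t) + 2 * c * W * e * T.
  have := Rintegral_cst_itv (2 * c * W * e) T0; rewrite subr0 => <-.
  have Qzi := integrable_quad cz.
  rewrite -RintegralD//; last exact: cst_integrable.
  apply: le_Rintegral => //; first exact: integrable_quad.
    by apply: eq_integrable (integrableD m0T Qzi (cst_integrable 0 T (2 * c * W * e))).
  move=> t; rewrite /= in_itv/= => tI.
  by apply: quad_close => //; [exact: ltW|exact: zW|exact: wW|exact: wz].
have h3 : \int[mu]_(t in `[0, T]) (v' t * p t (B2 (w t))) <=
    \int[mu]_(t in `[0, T]) (v t * p t (B2 (z t))) + (P * W * tau + P * e * V).
  have zi := integrable_pB2 vL1 cz.
  have i1 : mu.-integrable `[0, T] (EFin \o (fun t => P * W * `|v' t - v t|)).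
    by apply: eq_integrable (integrableZl m0T (P * W) dvi).
  have i2 : mu.-integrable `[0, T] (EFin \o (fun t => P * e * `|v t|)).
    by apply: eq_integrable (integrableZl m0T (P * e) avi).
  have i3 : mu.-integrable `[0, T] (EFin \o (fun t => P * W * `|v' t - v t| + P * e * `|v t|)).
    by apply: eq_integrable (integrableD m0T i1 i2).
  rewrite /tau /V -!RintegralZl// -!RintegralD//; apply: le_Rintegral => //.
  - exact: integrable_pB2.
  - by apply: eq_integrable (integrableD m0T zi i3).
  - move=> t; rewrite /= in_itv/= => tI.
    have -> : v' t * p t (B2 (w t)) = v t * p t (B2 (z t)) +
        ((v' t - v t) * p t (B2 (w t)) + v t * p t (B2 (w t - z t))).
      have e' : B2 (w t - z t) = B2 (w t) - B2 (z t) by rewrite linearB.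
      by rewrite e' dual_evalB; lra.
    rewrite lerD2l lerD// (le_trans (ler_norm _))// normrM mulrC.
      by rewrite ler_wpM2r// (le_trans (hPB _ _ tI))// ler_wpM2l// wW.
    by rewrite ler_wpM2r// (le_trans (hPB _ _ tI))// ler_wpM2l// wz.
apply: (le_trans (lerD (lerD h2 (ler_wpM2l (ler0n R 2) h3)) h1)).
rewrite -/tau; set i1 := Rintegral _ _ _; set i2 := Rintegral _ _ _.
set q := quad _ _.
rewrite -subr_ge0 [leRHS](_ : _ = T * (2 * c * W) * tau + 2 * P * W * e +
  2 * P * V * tau + 2 * cT * W * tau); last by lra.
by rewrite !addr_ge0// !mulr_ge0// ltW.
Qed.

End expansion.

(** * The second-order necessary condition *)
Section control_perturbation.
Context {R : realType}.
Notation mu := (@lebesgue_measure R).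

Lemma Linfty_norm_le (T C : R) (u : R -> R) : 0 <= C ->
  (forall t, `|u t| <= C) -> (Linfty_norm T u <= C%:E)%E.
Proof.
move=> C0 uC; rewrite /Linfty_norm unlock; case: ifPn => // _.
apply/ess_supP; apply: nearW => t /=.
rewrite lee_fin /patch; case: ifPn => // _; by rewrite normr0.
Qed.

Lemma Rintegral_ae0 a b (f : R -> R) :
  measurable_fun (`[a, b] : set (measurableTypeR R)) f ->
  {ae mu, forall t, a <= t <= b -> f t = 0} ->
  \int[mu]_(t in `[a, b]) f t = 0.
Proof.
move=> mf f0; rewrite /Rintegral (@ae_eq_integral _ _ _ mu _ (cst 0%E))//.
- by rewrite integral0.
- by apply/measurable_EFinP.
- by apply: ae_imply f0 => t h; rewrite /= in_itv/= => tI; rewrite h.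
Qed.

End control_perturbation.

Theorem theorem3p3
  (R : realType) (H : completeNormedModType R) (Hrefl : reflexive_space H)
  (T : R) (T_gt0 : 0 < T)
  (* the operator A, its semigroup exp(-tA), and the semigroup exp(-tA* ) *)
  (A : set (H * H)) (S : R -> {linear H -> H}) (genS : generates A S)
  (Sd : R -> {linear dual H -> dual H})
  (genSd : generates (adjoint_graph A) Sd)
  (Psi0 : H) (f : R -> H) (fL1 : bochner_L1 0 T f)
  (B1 : H) (B2 : {linear H -> H}) (cB2 : continuous B2)
  (* the state map u |-> Psi[u] *)
  (Psi : (R -> R) -> R -> H)
  (PsiP : forall u, L1 T u ->
     mild_solution S T Psi0 (fun t => f t + u t *: (B1 + B2 (Psi u t))) (Psi u))
  (Q QT : {linear H -> dual H}) (cQ : continuous Q) (cQT : continuous QT)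
  (symQ : forall x y, Q x y = Q y x) (symQT : forall x y, QT x y = QT y x)
  (Psid : R -> H) (Psid_Linfty : bochner_Linfty 0 T Psid) (PsidT : H)
  (alpha um uM : R) (um_lt_uM : um < uM)
  (uh : R -> R)
  (uh_min : weak_minimum T (admissible T um uM)
     (fun u => cost T alpha Q QT Psid PsidT u (Psi u)) uh)
  (* the costate associated with uh *)
  (ph : R -> dual H)
  (phP : backward_mild_solution Sd T (QT (Psi uh T - PsidT))
     (fun t => Q (Psi uh t - Psid t) + uh t *: adjoint cB2 (ph t)) ph)
  (* the linearized state map v |-> z[v] *)
  (z : (R -> R) -> R -> H)
  (zP : forall v, L1 T v ->
     mild_solution S T 0
       (fun t => uh t *: B2 (z v t) + v t *: (B1 + B2 (Psi uh t))) (z v)) :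
  forall v, critical_cone T um uM (switching alpha B1 B2 ph (Psi uh)) uh v ->
    0 <= second_variation T Q QT B2 ph (z v) v.
Proof.
move=> v [vL1 Lv v_um v_uM].
have T0 := ltW T_gt0.
have [c0 _] := genS.
have SdE := fun t p y => @adjoint_semigroupE R H A S Sd Hrefl genS genSd t p y.
have [[uhL1 uh_adm] [eps eps0 hmin]] := uh_min.
set mu := @lebesgue_measure R.
pose mR := measurableTypeR R.
have m0T : measurable (`[0, T] : set mR) by [].
pose psi := Psi uh.
have cpsi : {within `[0, T], continuous psi} := (PsiP uh uhL1).1.
have cz : {within `[0, T], continuous (z v)} := (zP v vL1).1.
pose sig := @trunc_size R.
pose tn := truncation T um uM uh v.
have sig0 n : 0 < sig n by exact: trunc_size_gt0.
have tnL1 n : L1 T (tn n) by exact: truncation_L1.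
pose un n t := uh t + sig n * tn n t.
have stnL1 n : L1 T (fun t => sig n * tn n t).
  by apply: eq_integrable (integrableZl m0T (sig n) (tnL1 n)).
have unL1 n : L1 T (un n).
  by apply: eq_integrable (integrableD m0T uhL1 (stnL1 n)).
pose w n t := (sig n)^-1 *: (Psi (un n) t - psi t).
(* The scaled increment w n, not the increment itself, is the variable of the
   expansion: it stays bounded and converges to z[v]. *)
have PsiE n : Psi (un n) = fun t => psi t + sig n *: w n t.
  apply/funext => t; rewrite /w scalerA divff ?gt_eqF// scale1r.
  by rewrite addrC subrK.
have cw n : {within `[0, T], continuous (w n)}.
  have /(within_continuous_clamp T0) c1 := (PsiP _ (unL1 n)).1.
  have /(within_continuous_clamp T0) c2 := cpsi.
  apply: clamp_within_continuous => s; apply: cvgZl_tmp.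
  by apply: cvgB; [exact: c1|exact: c2].
pose k n s := uh s *: B2 (w n s) + tn n s *: (B1 + B2 (psi s + sig n *: w n s)).
have kw n : weak_mild S T (k n) (w n).
  have h1 := mild_solution_weak (PsiP _ (unL1 n)).
  have h2 := mild_solution_weak (PsiP _ uhL1).
  apply: weak_mild_eq (weak_mildZ (sig n)^-1 (weak_mildB h1 h2)) => t tI; last first.
    by rewrite /w opprB addrA subrK.
  rewrite /k {1}/w.
  have -> : psi t + sig n *: w n t = Psi (un n) t by rewrite PsiE.
  set X := B1 + B2 (Psi (un n) t).
  rewrite [f t + un n t *: X]addrC [f t + uh t *: _]addrC opprD addrA addrAC addrK.
  have e : B2 ((sig n)^-1 *: (Psi (un n) t - psi t)) =
      (sig n)^-1 *: (X - (B1 + B2 (psi t))).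
    by rewrite linearZ linearB /X opprD addrACA subrr add0r.
  rewrite e /un scalerDl addrAC -scalerBr scalerDr; congr (_ + _).
    by rewrite !scalerA mulrC.
  by rewrite scalerA mulrA mulVf ?gt_eqF// mul1r.
have kz : weak_mild S T (fun t => uh t *: B2 (z v t) + v t *: (B1 + B2 (psi t))) (z v).
  apply: weak_mild_eq (mild_solution_weak (zP v vL1)) => // t _.
  by rewrite linear0 subr0.
have [b b0 Bb] := continuous_linear_bound cB2.
have b0' := ltW b0.
have cB : {within `[0, T], continuous (fun t => B1 + B2 (psi t))}.
  apply: (@within_continuous_postcomp _ _ _ _ _ psi (fun x => B1 + B2 x)) => //.
  by move=> x; apply: cvgD; [exact: cvg_cst|exact: cB2].
have [beta beta0 hbeta] := within_continuous_bounded T0 cB.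
have absi (x : R -> R) (C : R) : L1 T x ->
    mu.-integrable `[0, T] (EFin \o (fun t => C * `|x t|)).
  by move=> xi; apply: eq_integrable (integrableZl m0T C (integrable_norm xi)).
(* One kernel for all n, so that the Gronwall constant does not depend on n:
   sig n <= 1 and the truncations are dominated by v. *)
pose kap s := b * `|uh s| + b * `|v s|.
have kapi : mu.-integrable `[0, T] (EFin \o kap).
  by apply: eq_integrable (integrableD m0T (absi uh b uhL1) (absi v b vL1)).
have kap0 s : 0 <= s <= T -> 0 <= kap s by rewrite addr_ge0// mulr_ge0.
have [G G0 hG] := mild_gronwall c0 T0 kapi kap0.
pose V := \int[mu]_(t in `[0, T]) `|v t|.
have V0 : 0 <= V by apply: Rintegral_ge0.
have kE n s : k n s = uh s *: B2 (w n s) + tn n s *: (B1 + B2 (psi s)) +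
    (tn n s * sig n) *: B2 (w n s).
  have e : B2 (psi s + sig n *: w n s) = B2 (psi s) + sig n *: B2 (w n s).
    by rewrite linearD linearZ.
  by rewrite /k e addrA scalerDr scalerA addrA.
have tnv n s : `|tn n s| <= `|v s| by exact: truncation_norm_le.
have sig1 n : sig n <= 1 by exact: trunc_size_le1.
have tsE n s : `|tn n s * sig n| = `|tn n s| * sig n.
  by rewrite normrM (ger0_norm (ltW (sig0 n))).
have tsv n s : `|tn n s * sig n| <= `|v s|.
  by rewrite tsE (le_trans _ (tnv n s))// ler_piMr.
pose W' := G * (beta * V).
have wW' n t : 0 <= t <= T -> `|w n t| <= W'.
  rewrite /W' /V -RintegralZl//; last exact: (integrable_norm vL1).
  apply: (hG (k n) (w n)) => //.
  - exact: absi.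
  - by move=> s _; rewrite mulr_ge0.
  move=> s sI; rewrite kE addrAC (le_trans (ler_normD _ _))// lerD//.
    rewrite (le_trans (ler_normD _ _))// /kap mulrDl.
    rewrite (normrZ (uh s)) (normrZ (tn n s * sig n)) lerD//.
      by rewrite [b * _]mulrC -mulrA ler_wpM2l.
    rewrite [leRHS](_ : _ = `|v s| * (b * `|w n s|)); last by rewrite mulrCA mulrA.
    by apply: ler_pM => //; exact: tsv.
  by rewrite normrZ mulrC ler_pM// hbeta.
have W'0 : 0 <= W' by rewrite !mulr_ge0.
pose tau n := \int[mu]_(t in `[0, T]) `|tn n t - v t|.
pose en n := G * (beta * tau n + sig n * b * W' * V).
have dL1 n : L1 T (fun t => tn n t - v t).
  by apply: eq_integrable (integrableB m0T (tnL1 n) vL1).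
have tau0 n : 0 <= tau n by apply: Rintegral_ge0.
have en0 n : 0 <= en n.
  by rewrite mulr_ge0// addr_ge0// !mulr_ge0// ltW.
(* The difference of the two equations has the source
   uh B2 (w n - z) + (v_n - v) (B1 + B2 psi) + sig n v_n B2 (w n), whose last
   two terms tend to 0 in L^1. *)
have wz n t : 0 <= t <= T -> `|w n t - z v t| <= en n.
  pose r s := beta * `|tn n s - v s| + sig n * b * W' * `|v s|.
  have ri1 := absi _ beta (dL1 n); have ri2 := absi _ (sig n * b * W') vL1.
  have ri : mu.-integrable `[0, T] (EFin \o r).
    by apply: eq_integrable (integrableD m0T ri1 ri2).
  have -> : en n = G * \int[mu]_(s in `[0, T]) r s.
    have i1 : mu.-integrable `[0, T] (EFin \o (fun s => `|v s|)) := integrable_norm vL1.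
    have i2 : mu.-integrable `[0, T] (EFin \o (fun s => `|tn n s - v s|)) :=
      integrable_norm (dL1 n).
    by rewrite /r RintegralD// !RintegralZl.
  have cwz : {within `[0, T], continuous (fun t => w n t - z v t)}.
    have /(within_continuous_clamp T0) c1 := cw n.
    have /(within_continuous_clamp T0) c2 := cz.
    by apply: clamp_within_continuous => s; apply: cvgB; [exact: c1|exact: c2].
  apply: (hG _ _ r cwz (weak_mildB (kw n) kz)) => // s sI.
    by rewrite addr_ge0// !mulr_ge0// ltW.
  have -> : k n s - (uh s *: B2 (z v s) + v s *: (B1 + B2 (psi s))) =
      uh s *: B2 (w n s - z v s) + ((tn n s - v s) *: (B1 + B2 (psi s)) +
      (tn n s * sig n) *: B2 (w n s)).
    have e : B2 (w n s - z v s) = B2 (w n s) - B2 (z v s) by rewrite linearB.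
    have reorg (x1 x2 x3 x4 x5 : H) :
        x1 + x2 + x3 - (x4 + x5) = x1 - x4 + (x2 - x5 + x3).
      by rewrite opprD addrACA [x1 + x2 - x4]addrAC -addrA [x3 - x5]addrC (addrA x2).
    by rewrite kE e scalerBr scalerBl reorg.
  rewrite (le_trans (ler_normD _ _))// lerD//.
    rewrite normrZ /kap mulrDl [leLHS](_ : _ = `|uh s| * `|B2 (w n s - z v s)| + 0).
      by rewrite lerD ?mulr_ge0// [b * _]mulrC -mulrA ler_wpM2l.
    by rewrite addr0.
  rewrite (le_trans (ler_normD _ _))// /r lerD//.
    by rewrite normrZ mulrC ler_wpM2r// hbeta.
  rewrite normrZ tsE.
  rewrite [leRHS](_ : _ = (`|v s| * sig n) * (b * W')); last by lra.
  apply: ler_pM => //; first by rewrite mulr_ge0// ltW.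
    by rewrite ler_wpM2r// ltW.
  by rewrite (le_trans (Bb _))// ler_wpM2l// wW'.
have [Z Z0 hZ] := within_continuous_bounded T0 cz.
have WZ0 : 0 <= W' + Z by rewrite addr_ge0.
have [C C0 hC] := second_variation_close T0 cQ phP cQT cz vL1 WZ0.
have SVge n : n.+1%:R^-1 < eps -> 0 <= second_variation T Q QT B2 ph (w n) (tn n).
  move=> neps.
  have un_adm : admissible T um uM (un n).
    by split; [exact: unL1|exact: truncation_admissible].
  have un_close : (Linfty_norm T (un n \- uh)%R < eps%:E)%E.
    apply: (@le_lt_trans _ _ (n.+1%:R^-1)%:E); last by rewrite lte_fin.
    apply: Linfty_norm_le => // t; rewrite /un /= addrAC subrr add0r.
    exact: truncation_small.
  have := hmin _ un_adm un_close; rewrite /= PsiE.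
  rewrite (cost_expansion T0 c0 SdE cQ symQ symQT alpha Psid_Linfty uhL1 cpsi phP
    (cw n) (tnL1 n) (kw n)).
  rewrite Rintegral_ae0; last 2 first.
  - apply: measurable_funM; last by apply/measurable_EFinP; case/integrableP: (tnL1 n).
    apply: within_continuous_measurable; apply: clamp_within_continuous => s.
    have cpp := within_continuous_clamp T0 phP.1.
    have cBB := within_continuous_clamp T0 cB.
    by apply: cvgD; [exact: cvg_cst|exact: (continuous_pairing cpp cBB)].
  - apply: ae_imply Lv => t h tI; have tE : tn n t = v t \/ tn n t = 0 by exact: truncation_or.
    by have [->|->] := tE; [exact: h|rewrite mulr0].
  rewrite mulr0 addr0 lerDl pmulr_rge0// divr_gt0// exprn_gt0//.
apply/ler_addgt0Pr => e e0.
have tau_cvg : tau n @[n --> \oo] --> 0 by exact: truncation_cvg_L1.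
(* The summand 1 keeps the denominators positive when C vanishes. *)
have K0 : 0 < C * (G * beta + 1) + 1 by rewrite ltr_wpDl// mulr_ge0// addr_ge0// mulr_ge0.
have K0' : 0 < C * (G * b * W' * V) + 1 by rewrite ltr_wpDl// !mulr_ge0.
have e20 : 0 < e / 2 by rewrite divr_gt0.
have /cvgrPdist_le/(_ _ (divr_gt0 e20 K0)) h1 := tau_cvg.
have /cvgrPdist_le/(_ _ (divr_gt0 e20 K0')) h2 := @trunc_size_cvg0 R.
have h3 : \forall n \near \oo, n.+1%:R^-1 < eps.
  exists (Num.truncn eps^-1).+1 => // n /= en'.
  rewrite invf_plt ?posrE// (lt_le_trans (truncnS_gt _))// ler_nat.
  by rewrite (leq_trans en').
near \oo => n.
have tn1 : tau n <= e / 2 / (C * (G * beta + 1) + 1).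
  have : `|0 - tau n| <= e / 2 / (C * (G * beta + 1) + 1) by near: n.
  by rewrite sub0r normrN ger0_norm.
have sn1 : sig n <= e / 2 / (C * (G * b * W' * V) + 1).
  have : `|0 - sig n| <= e / 2 / (C * (G * b * W' * V) + 1) by near: n.
  by rewrite sub0r normrN gtr0_norm.
have neps : n.+1%:R^-1 < eps by near: n.
apply: (le_trans (SVge _ neps)).
apply: (le_trans (hC (w n) (tn n) (en n) (cw n) (tnL1 n) (en0 n) _ _ _)).
- by move=> t tI; rewrite (le_trans (hZ _ tI))// lerDr.
- by move=> t tI; rewrite (le_trans (wW' _ _ tI))// lerDl.
- by move=> t tI; exact: wz.
rewrite lerD2l -/(tau n).
have -> : C * (en n + tau n) =
    C * (G * beta + 1) * tau n + C * (G * b * W' * V) * sig n by rewrite /en; lra.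
rewrite [e]splitr lerD//.
  move: tn1; rewrite ler_pdivlMr// => /(le_trans _); apply.
  by rewrite mulrC ler_wpM2l// lerDl.
move: sn1; rewrite ler_pdivlMr// => /(le_trans _); apply.
by rewrite mulrC ler_wpM2l// ?lerDl// ltW.
Unshelve. all: by end_near. Qed.
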